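(* Let $T$ be a self-similar tiling with finite local complexity and expansion factor $\lambda$, and let $(G,S)$ be a recurrent pair for $T$. When $\psi^{(\infty)}$ is injective: (1) $\psi^{(1)}=\psi$; (2) if $z\in\partial T^{(0)}$ and $z\in\operatorname{supp}(t)$ for a tile $t\in T$, then $\psi^{(n)}(z)\in\operatorname{supp}(t)$ for all $n$; (3) $T$, $T^{(0)}$, $T^{(n)}$ and $T^{(\infty)}$ are mutually locally derivable for all $n\in\mathbb N$; and (4) for any $z\in\partial T^{(0)}$ and $n\in\mathbb N$, $\lambda^n\psi^{(\infty)}(z)=\psi^{(\infty)}\big((\lambda\psi)^n(z)\big)$.
   Context: Tilings. A prototile $p$ is a closed set $\operatorname{supp}(p)\subset\mathbb R^2$ homeomorphic to a closed disk together with a label; a prototile set $\mathcal P$ is a finite set of prototiles. A tile is a translate $t=p+x$ ($p\in\mathcal P$, $x\in\mathbb R^2$), with support $\operatorname{supp}(p)+x$ and the label of $p$. Tiles, patches, tilings are equivalent if they are translates of each other. A tiling $T$ is a countable collection of tiles whose supports cover $\mathbb R^2$ and have pairwise disjoint interiors; $\partial T=\bigcup_{t\in T}\partial(\operatorname{supp}(t))$. A patch is a finite set of tiles with connected union of supports and pairwise disjoint interiors. $T$ has finite local complexity (FLC) if it has finitely many two-tile patches up to translation. For a patch or tiling $Q$ and $B\subset\mathbb R^2$, $[B]^Q=\{q\in Q:\operatorname{supp}(q)\cap B\ne\varnothing\}$. A tiling $T'$ is locally derivable from $T$ if there is $R>0$ such that $[B_R(x)]^T=[B_R(y)]^T+z$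 implies $[\{x\}]^{T'}=[\{y\}]^{T'}+z$; $T,T'$ are mutually locally derivable (MLD) if each is locally derivable from the other. Self-similarity. $T$ is self-similar with expansion factor $\lambda>1$ if $\lambda\,\partial T\subset\partial T$ and whenever $t_1,t_2\in T$ are equivalent, the patches of $T$ enclosed by $\lambda\operatorname{supp}(t_1)$ and $\lambda\operatorname{supp}(t_2)$ are equivalent. It determines a substitution $\omega$: for $p\in\mathcal P$ choose $t=p+x\in T$; $\omega(p)$ is the patch of $T$ with support $\lambda\operatorname{supp}(t)$, translated by $-\lambda x$. Put $D_{pq}=\{d\in\mathbb R^2: q+d\in\omega(p)\}$ for $p,q\in\mathcal P$. Vertices and edges. On the disjoint union $\partial\mathcal P$ of the boundaries $\partial\operatorname{supp}(p)$ let $\sim_T$ be the equivalence relation generated by $a\sim_T b$ when $a\in\partial\operatorname{supp}(p)$, $b\in\partial\operatorname{supp}(q)$ and $p+x,q+y\in T$, $a+x=b+y$ for some $x,y$. A subset of $\partial\mathcal P$ is $T$-consistent if it is a union of classes. A natural vertex of $T$ is a point where three or more tiles meet; the vertex set of $\mathcal P$ is the smallest $T$-consistent set containing all representatives of natural vertices on prototiles; an edge of $p$ is a Jordan arc along $\partial\operatorname{supp}(p)$ joining neighbouring vertices. Geometric graphs. A geometric graph is the image of an embedding in the plane of the topological realization of a combinatorial graph (without degree-0 vertices); its vertices and edges are the images of those of the underlying combinatorial graph without degree-two vertices. Two geometric graphs are equivalent, $B\sim C$, if they are embeddings $\iota_B,\iota_C$ of the same combinatorial graph; this gives the homeomorphism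 $\iota_C\circ\iota_B^{-1}:B\to C$. A geometric graph $G$ on $\mathcal P$ is a disjoint union $\bigsqcup_{p\in\mathcal P}G_p$ of finite geometric graphs with $G_p\subset\operatorname{supp}(p)$; a vertex of $G_p$ on $\partial\operatorname{supp}(p)$ is a boundary vertex. $G$ is $T$-consistent if each $G_p$ meets $\partial\operatorname{supp}(p)$ only at boundary vertices and the boundary vertices of $G$ form a $T$-consistent set. The tiling $T_G$. $\Gamma(T,G)=\bigcup_{t=p+x\in T}(G_p+x)$. An empty Jordan curve in $\Gamma(T,G)$ is a Jordan curve in it containing no portion of $\Gamma(T,G)$ in its interior. When every arc of $\Gamma(T,G)$ is part of an empty Jordan curve (a standing assumption), $T_G$ is the tiling with boundary $\Gamma(T,G)$ whose tiles are the closed regions bounded by the empty Jordan curves $J$, labelled by the translation class of $[J]^T$. Recurrent pairs. For $B=\bigsqcup_p B_p$ with $B_p\subset\mathbb R^2$, $\mathcal R(B)_p=\bigcup_{q\in\mathcal P}\lambda^{-1}(B_q+D_{pq})$ (with $B_q+\varnothing=\varnothing$). A pair $(G,S)$ of $T$-consistent geometric graphs on $\mathcal P$ is a recurrent pair if (i) $S\subset\mathcal R^N(G)$ for some $N\in\mathbb N$; (ii) $G_p\sim S_p$ for all $p$, with homeomorphism $\widetilde\psi_p:G_p\to S_p$; (iii) $v$ is a boundary vertex of $G_p$ iff $\widetilde\psi_p(v)$ is a boundary vertex of $S_p$, in which case both lie in the same edge of $p$. Convention: after replacing $\omega,\lambda,\mathcal R$ by powers, it is assumed that $S\subset\mathcal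 R(G)$. The maps and tilings. $T^{(0)}=T_G$. Define $\psi:\partial T^{(0)}\to\mathbb R^2$ by $\psi(z)=\widetilde\psi_p(z-x)+x$ when $z\in\operatorname{supp}(t)$, $t=p+x\in T$. Then $\lambda\psi(\partial T^{(0)})\subset\partial T^{(0)}$; put $\psi^{(n)}(z)=\lambda^{-n}(\lambda\psi)^n(z)$, and let $\psi^{(\infty)}$ be the pointwise limit of $\psi^{(n)}$ (it exists and is continuous). $T^{(n)}$ is the tiling with tiles $t^{(n)}$, $t\in T^{(0)}$, where $t^{(n)}$ is supported on the set enclosed by $\psi^{(n)}(\partial t)$ and carries the label of $t$; $T^{(\infty)}$ (when $\psi^{(\infty)}$ is injective) is defined in the same way from $\psi^{(\infty)}$.
   Formalization: In local derivability z is taken to be x−y (arbitrary z is not even reflexive); the label of a tile of T_G is the translation class of the pair (J,[J]^T), not of [J]^T alone; that T_G is a tiling with finitely many prototiles and that ψ is well defined are explicit assumptions. *)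

(* Defs.v *)
From Stdlib Require Import Relation_Operators.
From mathcomp Require Import all_boot all_order all_algebra.
From mathcomp Require Import all_classical all_reals all_analysis.

Set Implicit Arguments.
Unset Strict Implicit.
Unset Printing Implicit Defensive.

Import Order.TTheory GRing.Theory Num.Theory.
Import numFieldNormedType.Exports.
Local Open Scope classical_set_scope.
Local Open Scope ring_scope.

Notation plane R := 'rV[R]_2.

(** * Plane topology *)

(* [f] is a homeomorphism from [A] onto [B] with inverse [g]; only the values
   of [f] on [A] and of [g] on [B] matter. *)
Definition homeo_on (X Y : topologicalType) (A : set X) (B : set Y)
    (f : X -> Y) (g : Y -> X) : Prop :=
  [/\ {within A, continuous f}, {within B, continuous g},
      (forall x, A x -> B (f x) /\ g (f x) = x)
    & (forall y, B y -> A (g y) /\ f (g y) = y)].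

Definition homeomorphic (X Y : topologicalType) (A : set X) (B : set Y) : Prop :=
  exists f g, homeo_on A B f g.

Definition embedding_on (X Y : topologicalType) (A : set X) (f : X -> Y) : Prop :=
  exists g, homeo_on A (f @` A) f g.

Definition sqnorm (R : realType) (z : plane R) : R := \sum_i z 0 i ^+ 2.

(* The norm of ['rV[R]_2] in the library is the sup norm; balls and disks here
   are the Euclidean ones. *)
Definition eball (R : realType) (x : plane R) (r : R) : set (plane R) :=
  [set y | sqnorm (y - x) < r ^+ 2].

Definition closed_disk (R : realType) : set (plane R) := [set z | sqnorm z <= 1].

Definition unit_circle (R : realType) : set (plane R) := [set z | sqnorm z = 1].

Definition bd (X : topologicalType) (A : set X) : set X := closure A `\` interior A.

Definition shift_set (R : realType) (x : plane R) (A : set (plane R)) :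
  set (plane R) := [set z + x | z in A].

Definition scale_set (R : realType) (c : R) (A : set (plane R)) :
  set (plane R) := [set c *: z | z in A].

Definition jordan_curve (R : realType) (J : set (plane R)) : Prop :=
  homeomorphic (@unit_circle R) J.

(* The union of the bounded components of the complement of [J]; for a Jordan
   curve this is its interior. *)
Definition inside (R : realType) (J : set (plane R)) : set (plane R) :=
  [set z | ~ J z /\ bounded_set (connected_component (~` J) z)].

Definition enclosed (R : realType) (J : set (plane R)) : set (plane R) :=
  J `|` inside J.

(** * Tiles, patches, tilings *)

Record tile (R : realType) (L : Type) : Type :=
  Tile { supp : set (plane R); label : L }.

Definition shift_tile (R : realType) (L : Type) (x : plane R) (t : tile R L) :
  tile R L := Tile (shift_set x (supp t)) (label t).

Definition shift_patch (R : realType) (L : Type) (x : plane R)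
    (Q : set (tile R L)) : set (tile R L) :=
  [set shift_tile x t | t in Q].

Definition is_prototile (R : realType) (L : Type) (p : tile R L) : Prop :=
  closed (supp p) /\ homeomorphic (@closed_disk R) (supp p).

(* Distinct prototiles are not translates of each other, so that a tile [p + x]
   determines both [p] and [x]. *)
Definition is_prototile_set (R : realType) (L : Type) (P : set (tile R L)) :
    Prop :=
  [/\ finite_set P, (forall p, P p -> is_prototile p)
    & (forall p x, P p -> P (shift_tile x p) -> shift_tile x p = p)].

Definition disjoint_interiors (R : realType) (L : Type) (Q : set (tile R L)) :
    Prop :=
  forall s t, Q s -> Q t -> s <> t ->
    interior (supp s) `&` interior (supp t) = set0.

(* [T] is a tiling with prototile set [P], every prototile being used. *)
Definition is_tiling (R : realType) (L : Type) (P T : set (tile R L)) : Prop :=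
  [/\ is_prototile_set P,
      countable T,
      (forall t, T t -> exists p x, P p /\ t = shift_tile x p)
      /\ (forall p, P p -> exists x, T (shift_tile x p)),
      \bigcup_(t in T) supp t = setT
    & disjoint_interiors T].

Definition tbd (R : realType) (L : Type) (T : set (tile R L)) : set (plane R) :=
  \bigcup_(t in T) bd (supp t).

Definition is_patch (R : realType) (L : Type) (Q : set (tile R L)) : Prop :=
  [/\ finite_set Q, connected (\bigcup_(t in Q) supp t) & disjoint_interiors Q].

Definition equiv_patch (R : realType) (L : Type) (Q Q' : set (tile R L)) : Prop :=
  exists x, Q' = shift_patch x Q.

Definition FLC (R : realType) (L : Type) (T : set (tile R L)) : Prop :=
  exists F : set (set (tile R L)), finite_set F /\
    forall s t, T s -> T t -> s <> t -> is_patch [set s; t] ->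
      exists2 Q, F Q & equiv_patch Q [set s; t].

(* [[B]^Q] *)
Definition meeting (R : realType) (L : Type) (Q : set (tile R L))
    (B : set (plane R)) : set (tile R L) :=
  [set q | Q q /\ supp q `&` B !=set0].

(* [T'] is locally derivable from [T]. *)
Definition locally_derivable (R : realType) (L L' : Type)
    (T : set (tile R L)) (T' : set (tile R L')) : Prop :=
  exists2 r : R, 0 < r & forall x y : plane R,
    meeting T (eball x r) = shift_patch (x - y) (meeting T (eball y r)) ->
    meeting T' [set x] = shift_patch (x - y) (meeting T' [set y]).

Definition MLD (R : realType) (L L' : Type)
    (T : set (tile R L)) (T' : set (tile R L')) : Prop :=
  locally_derivable T T' /\ locally_derivable T' T.

(** * Self-similarity and substitution *)

Definition enclosed_patch (R : realType) (L : Type) (T : set (tile R L))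
    (A : set (plane R)) : set (tile R L) :=
  [set t | T t /\ supp t `<=` A].

Definition self_similar (R : realType) (L : Type) (T : set (tile R L)) (lam : R) :
    Prop :=
  [/\ 1 < lam,
      scale_set lam (tbd T) `<=` tbd T
    & forall t x, T t -> T (shift_tile x t) ->
        equiv_patch (enclosed_patch T (scale_set lam (supp t)))
                    (enclosed_patch T (scale_set lam (supp (shift_tile x t))))].

Definition occurrence (R : realType) (L : Type) (T : set (tile R L))
    (p : tile R L) : plane R :=
  xget 0 [set x | T (shift_tile x p)].

Definition omega (R : realType) (L : Type) (T : set (tile R L)) (lam : R)
    (p : tile R L) : set (tile R L) :=
  let x := occurrence T p in
  shift_patch (- (lam *: x))
    (enclosed_patch T (scale_set lam (supp (shift_tile x p)))).

Definition digits (R : realType) (L : Type) (T : set (tile R L)) (lam : R)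
    (p q : tile R L) : set (plane R) :=
  [set d | omega T lam p (shift_tile d q)].

(** * Vertices and edges of prototiles *)

(* A pair [(p, a)] stands for the point [a] of the copy of the boundary of [p]
   in the disjoint union of the boundaries of the prototiles. *)
Definition bdP (R : realType) (L : Type) (P : set (tile R L)) :
    set (tile R L * plane R) :=
  [set pa | P pa.1 /\ bd (supp pa.1) pa.2].

Definition glued (R : realType) (L : Type) (P T : set (tile R L))
    (pa qb : tile R L * plane R) : Prop :=
  [/\ bdP P pa, bdP P qb
    & exists x y, [/\ T (shift_tile x pa.1), T (shift_tile y qb.1)
                    & pa.2 + x = qb.2 + y]].

Definition simT (R : realType) (L : Type) (P T : set (tile R L)) :
    tile R L * plane R -> tile R L * plane R -> Prop :=
  clos_refl_sym_trans _ (glued P T).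

Definition T_consistent (R : realType) (L : Type) (P T : set (tile R L))
    (C : set (tile R L * plane R)) : Prop :=
  C `<=` bdP P /\ forall pa qb, C pa -> simT P T pa qb -> C qb.

Definition natural_vertex (R : realType) (L : Type) (T : set (tile R L)) :
    set (plane R) :=
  [set v | exists t1 t2 t3,
     [/\ [/\ T t1, T t2 & T t3], [/\ t1 <> t2, t1 <> t3 & t2 <> t3]
       & [/\ supp t1 v, supp t2 v & supp t3 v]]].

Definition natural_vertex_reps (R : realType) (L : Type) (P T : set (tile R L)) :
    set (tile R L * plane R) :=
  [set pa | bdP P pa /\
     exists2 x, T (shift_tile x pa.1) & natural_vertex T (pa.2 + x)].

Definition vertex_set (R : realType) (L : Type) (P T : set (tile R L)) :
    set (tile R L * plane R) :=
  smallest (T_consistent P T) (natural_vertex_reps P T).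

Definition is_edge (R : realType) (L : Type) (P T : set (tile R L))
    (p : tile R L) (E : set (plane R)) : Prop :=
  E `<=` bd (supp p) /\
  exists f g, [/\ homeo_on (`[0, 1]%classic : set R) E f g,
                  vertex_set P T (p, f 0), vertex_set P T (p, f 1)
                & forall s, 0 < s < 1 -> ~ vertex_set P T (p, f s)].

(** * Geometric graphs *)

(* Simple graphs suffice: subdividing loops and multiple edges only adds
   vertices of degree two, which are discarded below. *)
Definition comb_graph (n : nat) (e : rel 'I_n) : Prop :=
  [/\ (0 < n)%N, symmetric e, irreflexive e & forall i, exists j, e i j].

Definition degree (n : nat) (e : rel 'I_n) (i : 'I_n) : nat := #|[set j | e i j]%SET|.

(* The segment spanned by the basis vectors of indices [i] and [j]. *)
Definition simplex (R : realType) (n : nat) (i j : 'I_n) : set 'rV[R]_n :=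
  [set x | exists2 s : R, 0 <= s <= 1
             & x = (1 - s) *: delta_mx 0 i + s *: delta_mx 0 j].

(* Topological realization, as a one-dimensional simplicial complex. *)
Definition realization (R : realType) (n : nat) (e : rel 'I_n) : set 'rV[R]_n :=
  [set x | exists i j, e i j /\ simplex i j x].

(* [B] is the image of the embedding [iota] of the realization of [e]. *)
Definition presents (R : realType) (n : nat) (e : rel 'I_n)
    (iota : 'rV[R]_n -> plane R) (B : set (plane R)) : Prop :=
  [/\ comb_graph e, embedding_on (@realization R n e) iota
    & B = iota @` @realization R n e].

Definition geo_graph (R : realType) (B : set (plane R)) : Prop :=
  exists n (e : rel 'I_n) iota, presents e iota B.

Definition geo_vertex (R : realType) (B : set (plane R)) : set (plane R) :=
  [set v | exists n (e : rel 'I_n) iota i,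
     [/\ presents e iota B, degree e i <> 2%N & v = iota (delta_mx 0 i)]].

Definition geo_arc (R : realType) (B A : set (plane R)) : Prop :=
  exists n (e : rel 'I_n) iota i j,
    [/\ presents e iota B, e i j & A = iota @` @simplex R n i j].

(* [B] and [C] are embeddings of the same combinatorial graph, and [h] is the
   resulting homeomorphism from [B] to [C]. *)
Definition geo_equiv (R : realType) (B C : set (plane R))
    (h : plane R -> plane R) : Prop :=
  exists n (e : rel 'I_n) iotaB iotaC,
    [/\ presents e iotaB B, presents e iotaC C
      & forall x, @realization R n e x -> h (iotaB x) = iotaC x].

Definition boundary_vertex (R : realType) (L : Type) (p : tile R L)
    (B : set (plane R)) : set (plane R) :=
  geo_vertex B `&` bd (supp p).

Definition geo_graph_on (R : realType) (L : Type) (P : set (tile R L))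
    (G : tile R L -> set (plane R)) : Prop :=
  forall p, P p -> geo_graph (G p) /\ G p `<=` supp p.

Definition consistent_graph (R : realType) (L : Type) (P T : set (tile R L))
    (G : tile R L -> set (plane R)) : Prop :=
  [/\ geo_graph_on P G,
      (forall p, P p -> G p `&` bd (supp p) `<=` boundary_vertex p (G p))
    & T_consistent P T [set pv | P pv.1 /\ boundary_vertex pv.1 (G pv.1) pv.2]].

(** * The tiling T_G *)

Definition Gamma (R : realType) (L : Type) (P T : set (tile R L))
    (G : tile R L -> set (plane R)) : set (plane R) :=
  [set z | exists p x, [/\ P p, T (shift_tile x p) & shift_set x (G p) z]].

Definition empty_jordan_curve (R : realType) (Ga J : set (plane R)) : Prop :=
  [/\ jordan_curve J, J `<=` Ga & inside J `&` Ga = set0].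

Definition arcs_on_empty_curves (R : realType) (L : Type) (P T : set (tile R L))
    (G : tile R L -> set (plane R)) : Prop :=
  forall p x A, P p -> T (shift_tile x p) -> geo_arc (G p) A ->
    exists2 J, empty_jordan_curve (Gamma P T G) J & shift_set x A `<=` J.

(* The translation class of [[J]^T] records the position of the patch relative
   to [J]: two curves get the same label when a single translation carries one
   curve and its patch to the other. *)
Definition patch_class (R : realType) (L : Type) (J : set (plane R))
    (Q : set (tile R L)) : set (set (plane R) * set (tile R L)) :=
  [set JQ | exists z, JQ = (shift_set z J, shift_patch z Q)].

Definition TG (R : realType) (L : Type) (P T : set (tile R L))
    (G : tile R L -> set (plane R)) :
    set (tile R (set (set (plane R) * set (tile R L)))) :=
  [set t | exists2 J, empty_jordan_curve (Gamma P T G) J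
             & t = Tile (enclosed J) (patch_class J (meeting T J))].

(** * Recurrent pairs *)

Definition Rop (R : realType) (L : Type) (P T : set (tile R L)) (lam : R)
    (B : tile R L -> set (plane R)) (p : tile R L) : set (plane R) :=
  [set z | exists q d, [/\ P q, digits T lam p q d
                         & scale_set lam^-1 (shift_set d (B q)) z]].

Definition recurrent_pair (R : realType) (L : Type) (P T : set (tile R L))
    (lam : R) (G S : tile R L -> set (plane R))
    (psit : tile R L -> plane R -> plane R) : Prop :=
  [/\ consistent_graph P T G /\ consistent_graph P T S,
      (exists N : nat, forall p, P p -> S p `<=` iter N (Rop P T lam) G p),
      (forall p, P p -> geo_equiv (G p) (S p) (psit p))
    & forall p v, P p -> G p v ->
        (boundary_vertex p (G p) v <-> boundary_vertex p (S p) (psit p v)) /\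
        (boundary_vertex p (G p) v ->
           exists E, [/\ is_edge P T p E, E v & E (psit p v)])].

(** * The maps psi and the deformed tilings *)

(* [psi] is the map given tile by tile by [psit] on the boundary of [T0]; the
   condition forces the local formulas to agree where tiles of [T] meet. *)
Definition is_psi (R : realType) (L L' : Type) (P T : set (tile R L))
    (T0 : set (tile R L')) (psit : tile R L -> plane R -> plane R)
    (psi : plane R -> plane R) : Prop :=
  forall z p x, tbd T0 z -> P p -> T (shift_tile x p) ->
    supp (shift_tile x p) z -> psi z = psit p (z - x) + x.

Definition lampsi (R : realType) (lam : R) (psi : plane R -> plane R)
    (z : plane R) : plane R := lam *: psi z.

Definition psin (R : realType) (lam : R) (psi : plane R -> plane R) (n : nat)
    (z : plane R) : plane R := lam ^- n *: iter n (lampsi lam psi) z.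

Definition psi_inf (R : realType) (lam : R) (psi : plane R -> plane R)
    (z : plane R) : plane R := lim (psin lam psi n z @[n --> \oo]).

Definition deform (R : realType) (L : Type) (f : plane R -> plane R)
    (T0 : set (tile R L)) : set (tile R L) :=
  [set Tile (enclosed (f @` bd (supp t))) (label t) | t in T0].

(* Main.v *)
Require Import Defs.
From Stdlib Require Import Relation_Operators.
From mathcomp Require Import all_boot all_order all_algebra ring lra zify.
From mathcomp Require Import all_classical all_reals all_analysis.
Import Order.TTheory GRing.Theory Num.Theory.
Import numFieldNormedType.Exports.
Set Implicit Arguments.
Unset Strict Implicit.
Unset Printing Implicit Defensive.
Local Open Scope classical_set_scope.
Local Open Scope ring_scope.

(* Everything local to a tile [t = p + x] of [T] is determined by [p] up to the
   translation [x]: by self-similarity the patch of [T] inside [lam t] is, up to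
   the translation [lam x], the one given by the digits of [p], so the inclusion
   [S <= R(G)] puts [lam psi z] on the graph of a tile inside [lam t] that moves
   with [t].  Iterating, [psi^(n) z] stays in [t] and commutes with every
   translation that carries [t] to another tile of [T]; the displacements
   [psi^(n+1) - psi^(n)] decay like [lam^-n], so the same holds for the limit.
   A map with these two properties deforms [T_G] into a tiling that is MLD with
   [T]: locally, matching patches of [T] deform in the same way; conversely the
   label of a deformed tile records the patch of [T] around the original Jordan
   curve up to translation, and its support fixes that translation.

   Two facts of plane topology enter.  Invariance of domain shows that tiles
   are regular closed with connected interior, so that a tile of [T] meeting the
   interior of [lam t] lies inside [lam t].  Together with the fact that no
   proper subset of a Jordan curve is a Jordan curve, it shows that a Jordan
   curve enclosing a disk is the boundary of that disk, so that
   [Gamma(T, G)] is the boundary of [T_G]. *)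

(** * A discrete Sperner lemma *)

(* The three colours are encoded by pairs of signs: [colA] if the first sign is
   positive, and otherwise [colB] or [colC] according to the second one. *)
Definition colA (c : bool * bool) := c.1.
Definition colB (c : bool * bool) := ~~ c.1 && c.2.
Definition colC (c : bool * bool) := ~~ c.1 && ~~ c.2.

(** A discrete 1-form: it counts, with sign, passages from colour C to colour B along an oriented
    edge, and ignores edges with an end of colour A. *)
Definition edge_weight (c d : bool * bool) : int :=
  if c.1 || d.1 then 0 else (d.2 : nat)%:Z - (c.2 : nat)%:Z.

Definition tricolored (s : seq (bool * bool)) :=
  [&& has colA s, has colB s & has colC s].

(** A discrete Stokes identity: the circulation round a cell vanishes, since without A the weights
    are differences of the second sign, and without B or without C they are all zero. *)
Lemma cell_weight (c00 c10 c01 c11 : bool * bool) :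
  ~~ tricolored [:: c00; c10; c01; c11] ->
  edge_weight c10 c11 - edge_weight c00 c01 =
  edge_weight c01 c11 - edge_weight c00 c10.
Proof.
by case: c00 => [[] []]; case: c10 => [[] []]; case: c01 => [[] []];
   case: c11 => [[] []].
Qed.

(** The signed count [V i] of C-to-B passages up column [i] is 0 on the right side, which is all A,
    and 1 on the left side, which avoids A and goes from C to B. Without a tricoloured cell it would
    be constant. *)
Lemma grid_tricolored (n : nat) (c : nat -> nat -> bool * bool) :
    (forall j, (j <= n)%N -> colA (c n j)) ->
    (forall j, (j <= n)%N -> ~~ colA (c 0 j)) ->
    (forall i, (i <= n)%N -> ~~ colC (c i n)) ->
    (forall i, (i <= n)%N -> ~~ colB (c i 0)) ->
  exists i j, [/\ (i < n)%N, (j < n)%N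
    & tricolored [:: c i j; c i.+1 j; c i j.+1; c i.+1 j.+1]].
Proof.
rewrite /colA /colB /colC => cr cl ct cb; apply: contrapT => none.
pose V i := \sum_(0 <= j < n) edge_weight (c i j) (c i j.+1).
have Vn : V n = 0.
  rewrite /V big_nat_cond big1 // => j; rewrite andbT => /andP[_ jn].
  by rewrite /edge_weight cr // ltnW.
have V0 : V 0 = 1.
  have -> : V 0 = \sum_(0 <= j < n) (((c 0 j.+1).2 : nat)%:Z - ((c 0 j).2 : nat)%:Z).
    rewrite /V; apply: eq_big_nat => j /andP[_ jn].
    by rewrite /edge_weight (negbTE (cl _ jn)) (negbTE (cl _ (ltnW jn))).
  rewrite telescope_sumr //.
  have := cl n (leqnn _); have := ct 0 isT; have := cl 0 isT; have := cb 0 isT.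
  by case: (c 0 0) => [[] []]; case: (c 0 n) => [[] []].
suff VE i : (i <= n)%N -> V i = V 0 by move: (VE n (leqnn _)); rewrite Vn V0.
elim: i => // i IH i_n; rewrite -IH; last exact: ltnW.
(* By the cell identity the difference of neighbouring columns telescopes to the weights of one top
   and one bottom edge; these vanish, as the top has no C and the bottom no B. *)
apply/eqP; rewrite -subr_eq0 /V -sumrB.
rewrite (_ : \sum_(0 <= j < n) _ = \sum_(0 <= j < n)
  (edge_weight (c i j.+1) (c i.+1 j.+1) - edge_weight (c i j) (c i.+1 j))); last first.
  apply: eq_big_nat => j /andP[_ jn]; apply: cell_weight; apply/negP => tri.
  by apply: none; exists i, j.
rewrite (telescope_sumr (fun j => edge_weight (c i j) (c i.+1 j))) // subr_eq0.
have := ct i (ltnW i_n); have := ct i.+1 i_n.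
have := cb i (ltnW i_n); have := cb i.+1 i_n.
by case: (c i 0) => [[] []]; case: (c i.+1 0) => [[] []];
   case: (c i n) => [[] []]; case: (c i.+1 n) => [[] []].
Qed.

(** * Metric preliminaries *)

Section EpsDelta.
Context {R : realType} {V W : normedModType R}.
Implicit Types (A B : set V) (f g : V -> W).

Lemma within_continuousP A f : {within A, continuous f} <->
  forall x, A x -> forall e, 0 < e -> exists2 d, 0 < d &
    forall y, A y -> `|x - y| < d -> `|f x - f y| < e.
Proof.
split=> [/subspace_continuousP cf x Ax e e0|cf].
  have /cvgrPdist_lt /(_ e e0) := cf x Ax; rewrite near_withinE.
  case/nbhs_ballP => d /= d0 dP; exists d => // y Ay xy.
  by apply: dP; rewrite -?ball_normE.
apply/subspace_continuousP => x Ax; apply/cvgrPdist_lt => e e0.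
have [d d0 dP] := cf x Ax e e0.
rewrite near_withinE; apply/nbhs_ballP; exists d => //= y.
by rewrite -ball_normE /= => xy Ay; apply: dP.
Qed.

Lemma compact_unif_cont A f : compact A -> {within A, continuous f} ->
  forall e, 0 < e -> exists2 d, 0 < d &
    forall x y, A x -> A y -> `|x - y| < d -> `|f x - f y| < e.
Proof.
move=> /compact_near_coveringP cA /within_continuousP cf e e0.
have e20 : 0 < e / 2 by rewrite divr_gt0.
have := cA R 0^'+ (fun d x => A x -> forall y, A y -> `|x - y| < d -> `|f x - f y| < e) _.
case=> [x Ax|d /= d0 dP].
  have [d d0 dP] := cf x Ax _ e20.
  near=> x' t => Ax' y Ay x'y.
  have xx' : `|x - x'| < d / 2.
    by near: x'; apply/nbhs_ballP; exists (d / 2); rewrite /= ?divr_gt0 // -ball_normE.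
  have td : t <= d / 2 by near: t; apply: nbhs_right_le; rewrite divr_gt0.
  rewrite (splitr e) (le_lt_trans (ler_distD (f x) _ _)) // ltrD //.
    by rewrite distrC dP // (lt_trans xx') // ltr_pdivrMr // ltr_pMr // ltr1n.
  apply: dP => //; rewrite (splitr d) (le_lt_trans (ler_distD x' _ _)) // ltrD //.
  exact: lt_le_trans td.
exists (d / 2); first by rewrite divr_gt0.
move=> x y Ax Ay xy; apply: (dP (d / 2)) => //=; last by rewrite divr_gt0.
rewrite sub0r normrN gtr0_norm ?divr_gt0 //.
by rewrite ltr_pdivrMr // ltr_pMr // ltr1n.
Unshelve. all: by end_near. Qed.

End EpsDelta.

Section Plane.
Context {R : realType}.
Implicit Types (x y : plane R) (a b r : R).

Definition vec2 a b : plane R := \row_(i < 2) (if i == 0 then a else b).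

Lemma vec20 a b : vec2 a b 0 0 = a.
Proof. by rewrite mxE. Qed.

Lemma vec21 a b : vec2 a b 0 1 = b.
Proof. by rewrite mxE. Qed.

Lemma row2P x y : x 0 0 = y 0 0 -> x 0 1 = y 0 1 -> x = y.
Proof.
move=> e0 e1; apply/rowP => i.
by case: (unliftP 0 i) => [j|] ->; rewrite ?e0 // (ord1 j) (_ : lift _ _ = 1) //; apply: val_inj.
Qed.

Lemma sqnormE x : sqnorm x = x 0 0 ^+ 2 + x 0 1 ^+ 2.
Proof.
rewrite /sqnorm big_ord_recl big_ord_recl big_ord0 addr0 (_ : lift _ _ = 1) //.
exact: val_inj.
Qed.

Lemma norm2E x : `|x| = Num.max `|x 0 0| `|x 0 1|.
Proof.
apply/eqP; rewrite eq_le; apply/andP; split.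
  rewrite {1}/Num.norm /= mx_normrE; apply/bigmax_leP; split=> [|[i j] _ /=].
    by rewrite le_max normr_ge0.
  rewrite (ord1 i) le_max.
  case: (unliftP 0 j) => [k|] ->; last by rewrite lexx.
  by rewrite (ord1 k) (_ : lift _ _ = 1) ?lexx ?orbT //; apply: val_inj.
rewrite ge_max; apply/andP; split; rewrite [leRHS]/Num.norm /= mx_normrE;
  apply/bigmax_geP; right => /=.
  by exists (0, 0).
by exists (0, 1).
Qed.

Lemma norm2_le x r : (`|x| <= r) = (`|x 0 0| <= r) && (`|x 0 1| <= r).
Proof. by rewrite norm2E ge_max. Qed.

Lemma norm2_lt x r : (`|x| < r) = (`|x 0 0| < r) && (`|x 0 1| < r).
Proof. by rewrite norm2E gt_max. Qed.

Lemma dist2_le x y r :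
  (`|x - y| <= r) = (`|x 0 0 - y 0 0| <= r) && (`|x 0 1 - y 0 1| <= r).
Proof. by rewrite norm2_le !mxE. Qed.

Lemma dist2_lt x y r :
  (`|x - y| < r) = (`|x 0 0 - y 0 0| < r) && (`|x 0 1 - y 0 1| < r).
Proof. by rewrite norm2_lt !mxE. Qed.

End Plane.

(** * Three colours on a fine grid over a square *)

Section Invariance.
Context {R : realType}.

Definition square (c : plane R) (r : R) : set (plane R) := [set x | `|x - c| <= r].

Lemma square_tricolored (c : plane R) (r eta : R) (chi : plane R -> bool * bool) :
    0 < r -> 0 < eta ->
    (forall x, square c r x -> x 0 0 = c 0 0 + r -> colA (chi x)) ->
    (forall x, square c r x -> x 0 0 = c 0 0 - r -> ~~ colA (chi x)) ->
    (forall x, square c r x -> x 0 1 = c 0 1 + r -> ~~ colC (chi x)) ->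
    (forall x, square c r x -> x 0 1 = c 0 1 - r -> ~~ colB (chi x)) ->
  exists x y z, [/\ [/\ colA (chi x), colB (chi y) & colC (chi z)],
    [/\ square c r x, square c r y & square c r z]
    & [/\ `|x - y| < eta, `|x - z| < eta & `|y - z| < eta]].
Proof.
move=> r0 eta0 cA cnA cnC cnB.
(* [m] subdivisions give mesh [2 * r / m < eta]; the successor keeps [m] positive. *)
pose m := (Num.bound (2 * r / eta)).+1; pose n : R := m%:R.
have n0 : 0 < n by rewrite ltr0n.
have rn : 2 * r < eta * n.
  rewrite [ltRHS]mulrC -ltr_pdivrMr //.
  have h : 0 <= 2 * r / eta by rewrite divr_ge0 ?mulr_ge0 // ltW.
  by rewrite (lt_le_trans (archi_boundP h)) // ler_nat.
pose u (x : R) (i : nat) : R := x + r * (2 * (i%:R / n) - 1).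
have u0 x : u x 0%N = x - r by rewrite /u mul0r mulr0 sub0r mulrN1.
have um x : u x m = x + r by rewrite /u divff ?gt_eqF // mulr1; ring.
have uP x i : (i <= m)%N -> `|u x i - x| <= r.
  move=> im; rewrite /u addrAC subrr add0r.
  have i0 : 0 <= i%:R / n by rewrite divr_ge0.
  have i1 : i%:R / n <= 1 by rewrite ler_pdivrMr // mul1r ler_nat.
  rewrite normrM gtr0_norm // -[leRHS]mulr1 ler_pM2l // ler_norml; lra.
have ud x i (a b : bool) : `|u x (i + a)%N - u x (i + b)%N| < eta.
  have -> : u x (i + a)%N - u x (i + b)%N = 2 * r / n * (a%:R - b%:R).
    by rewrite /u !natrD; field; rewrite gt_eqF.
  rewrite normrM ger0_norm; last by rewrite divr_ge0 ?mulr_ge0 // ltW.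
  have h : 2 * r / n < eta by rewrite ltr_pdivrMr.
  have h0 : 0 <= 2 * r / n by rewrite divr_ge0 ?mulr_ge0 // ltW.
  by case: a b => [] []; rewrite ?subrr ?sub0r ?subr0 ?normrN ?normr0 ?normr1
    ?mulr0 ?mulr1.
pose p i j := vec2 (u (c 0 0) i) (u (c 0 1) j).
have pS i j : (i <= m)%N -> (j <= m)%N -> square c r (p i j).
  move=> im jm; rewrite /square /= norm2_le.
  by rewrite !mxE /= !uP.
have [||||i [j [im jm]]] := @grid_tricolored m (fun i j => chi (p i j)).
- by move=> j jm; apply: cA; [exact: pS | rewrite vec20 um].
- by move=> j jm; apply: cnA; [exact: pS | rewrite vec20 u0].
- by move=> i im; apply: cnC; [exact: pS | rewrite vec21 um].
- by move=> i im; apply: cnB; [exact: pS | rewrite vec21 u0].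
have corner (q : pred (bool * bool)) :
    has q [:: chi (p i j); chi (p i.+1 j); chi (p i j.+1); chi (p i.+1 j.+1)] ->
    exists a b : bool, q (chi (p (i + a)%N (j + b)%N)).
  rewrite /= orbF => /or4P[] qP.
  - by exists false, false; rewrite !addn0.
  - by exists true, false; rewrite addn0 addn1.
  - by exists false, true; rewrite addn0 addn1.
  - by exists true, true; rewrite !addn1.
case/and3P => /corner[a1 [b1 c1]] /corner[a2 [b2 c2]] /corner[a3 [b3 c3]].
exists (p (i + a1)%N (j + b1)%N), (p (i + a2)%N (j + b2)%N), (p (i + a3)%N (j + b3)%N).
have le1 (k : nat) (a : bool) : (k < m)%N -> (k + a <= m)%N.
  by case: a; rewrite ?addn1 ?addn0 // => /ltnW.
split=> //; first by split; apply: pS; apply: le1.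
by split; rewrite norm2_lt !mxE /= !ud.
Qed.

End Invariance.

(** * Directions and sectors in the plane *)

Section Sectors.
Context {R : realType}.
Implicit Types (x y z : plane R) (m : nat).

(** The l^1 norm: on its unit circle the first coordinate fixes the second up to sign, so sectors
    can be cut out by intervals of one coordinate. *)
Definition norm1 y : R := `|y 0 0| + `|y 0 1|.

Lemma norm1_ge y : `|y| <= norm1 y.
Proof. by rewrite norm2_le /norm1 lerDl normr_ge0 lerDr normr_ge0. Qed.

Lemma norm1_le y : norm1 y <= 2 * `|y|.
Proof.
have := lexx `|y|; rewrite [in X in X -> _]norm2_le => /andP[h0 h1].
by rewrite /norm1 mulr_natl mulr2n lerD.
Qed.

Lemma norm1D y z : norm1 (y + z) <= norm1 y + norm1 z.
Proof.
rewrite /norm1 !mxE addrACA lerD ?ler_normD //.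
Qed.

Lemma norm1N y : norm1 (- y) = norm1 y.
Proof. by rewrite /norm1 !mxE !normrN. Qed.

Lemma norm1_lip y z : `|norm1 y - norm1 z| <= 2 * `|y - z|.
Proof.
apply: le_trans (norm1_le _).
have h1 := norm1D (y - z) z; have h2 := norm1D (z - y) y.
rewrite !subrK in h1 h2; have h3 := norm1N (y - z); rewrite opprB in h3.
by rewrite ler_norml; lra.
Qed.

Definition direction y : plane R := (norm1 y)^-1 *: y.

Lemma norm1_direction y : 0 < norm1 y -> norm1 (direction y) = 1.
Proof.
move=> y0; rewrite /norm1 /direction !mxE !normrM normfV (gtr0_norm y0) -mulrDr.
by rewrite mulVf // gt_eqF.
Qed.

(** The difference is [(y - z) + (norm1 z - norm1 y) *: direction z] divided by [norm1 y]; the first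
    term contributes 1 to the constant, the second 2 through [norm1_lip]. *)
Lemma direction_lip r y z : 0 < r -> r <= norm1 y -> r <= norm1 z ->
  `|direction y - direction z| <= 3 * `|y - z| / r.
Proof.
move=> r0 ry rz.
have y0 : 0 < norm1 y := lt_le_trans r0 ry.
have z0 : 0 < norm1 z := lt_le_trans r0 rz.
have -> : direction y - direction z =
    (norm1 y)^-1 *: ((y - z) + (norm1 z - norm1 y) *: direction z).
  rewrite /direction scalerDr scalerBr !scalerA -addrA; congr (_ + _).
  rewrite -!scaleNr -scalerDl; congr (_ *: _); field.
  by rewrite !gt_eqF.
rewrite normrZ normfV (gtr0_norm y0) mulrC.
apply: (@le_trans _ _ (3 * `|y - z| / norm1 y)); last first.
  by rewrite ler_wpM2l ?mulr_ge0 // lef_pV2 // posrE.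
rewrite ler_pM2r ?invr_gt0 // (le_trans (ler_normD _ _)) // normrZ.
have h1 : `|direction z| <= 1 by rewrite -(norm1_direction z0) norm1_ge.
have h2 := norm1_lip z y; rewrite (distrC z) in h2.
have h3 : `|norm1 z - norm1 y| * `|direction z| <= `|norm1 z - norm1 y| * 1.
  exact: ler_wpM2l.
lra.
Qed.

(** Splits the displacement into an angular part, at most the outer radius times the change of
    direction, and a radial part, at most the width of the ring. *)
Lemma dist_direction r d y z : 0 < norm1 y -> 0 < norm1 z ->
    r - d <= norm1 y <= r -> r - d <= norm1 z <= r ->
  `|y - z| <= r * `|direction y - direction z| + d.
Proof.
move=> y0 z0 yr zr.
have -> : y - z = norm1 y *: (direction y - direction z) + (norm1 y - norm1 z) *: direction z.
  rewrite /direction scalerBr scalerBl !scalerA !divff ?gt_eqF // !scale1r.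
  by rewrite addrA subrK.
rewrite (le_trans (ler_normD _ _)) // lerD // normrZ.
  by rewrite gtr0_norm // ler_wpM2r //; lra.
have h1 : `|direction z| <= 1 by rewrite -(norm1_direction z0) norm1_ge.
have h3 : `|norm1 y - norm1 z| * `|direction z| <= `|norm1 y - norm1 z| * 1.
  exact: ler_wpM2l.
have h : `|norm1 y - norm1 z| <= d by rewrite ler_norml; lra.
lra.
Qed.

(* The sectors of the unit [l^1]-circle over the intervals [[k/m, (k+1)/m)] of
   the first coordinate: two of them for most [k], but a single one around
   each of the two points where the circle meets the first axis. *)
Definition sector_index m y : int :=
  Num.min (Num.floor (m%:R * direction y 0 0)) (m%:Z - 1).

Definition sector m y : int * bool :=
  let k := sector_index m y in
  (k, [|| k == m%:Z - 1, k == - m%:Z | 0 <= direction y 0 1]).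

Lemma sector_bounds m y : (1 < m)%N -> 0 < norm1 y ->
  let k := sector_index m y in
  [/\ - m%:Z <= k <= m%:Z - 1,
      k%:~R <= m%:R * direction y 0 0 <= k%:~R + 1
    & (k == m%:Z - 1) || (m%:R * direction y 0 0 < k%:~R + 1)].
Proof.
move=> m1 y0 /=; rewrite /sector_index; set u := direction y 0 0.
have m0 : (0 : R) < m%:R by rewrite ltr0n ltnW.
have /[!ler_norml] /andP[um u1] : `|u| <= 1.
  by rewrite -(norm1_direction y0) /norm1 lerDl.
have /andP[fl fu] : ((Num.floor (m%:R * u))%:~R <= m%:R * u < (Num.floor (m%:R * u) + 1)%:~R).
  by rewrite floor_le floorD1_gt.
have fm : - m%:Z <= Num.floor (m%:R * u).
  rewrite floor_ge_int rmorphN /= -[leLHS]mulr1 mulNr -mulrN.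
  by rewrite ler_pM2l.
rewrite intrD in fu.
have mu : m%:R * u <= m%:R by rewrite -[leRHS]mulr1 ler_pM2l.
case: (leP (Num.floor (m%:R * u)) (m%:Z - 1)) => h.
  split; first by rewrite fm h.
    by rewrite fl ltW.
  by rewrite fu orbT.
split; [lia| |by rewrite eqxx].
have := ltW h; rewrite -(ler_int R) intrD /= => h'.
by rewrite subrK mu andbT; apply: le_trans fl.
Qed.

(** After scaling by [m], the first coordinates share a unit interval and [|U| + |V| = m]. In the
    two end sectors both second coordinates are at most 1 in size; elsewhere their signs agree and
    their variation is that of [|U|]. *)
Lemma same_sector_close m y z : (1 < m)%N -> 0 < norm1 y -> 0 < norm1 z ->
  sector m y = sector m z -> `|direction y - direction z| <= 2 / m%:R.
Proof.
move=> m1 y0 z0 yz.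
have m0 : (0 : R) < m%:R by rewrite ltr0n ltnW.
have [_ ky _] := sector_bounds m1 y0; have [_ kz _] := sector_bounds m1 z0.
have eb := congr1 snd yz.
have ek : sector_index m y = sector_index m z := congr1 fst yz.
move: ky kz eb; rewrite /sector /= -ek.
move: (sector_index m y) (norm1_direction y0) (norm1_direction z0) => k.
rewrite /norm1 dist2_le.
move: (direction y 0 0) (direction y 0 1) (direction z 0 0) (direction z 0 1) => u v u' v'.
move=> e1 e2 ku ku' eb.
have scale (a b : R) : `|m%:R * a - m%:R * b| <= 2 -> `|a - b| <= 2 / m%:R.
  by rewrite -mulrBr normrM gtr0_norm // ler_pdivlMr // mulrC.
have {e1} : `|m%:R * u| + `|m%:R * v| = m%:R by rewrite !normrM !normr_nat -mulrDr e1 mulr1.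
have {e2} : `|m%:R * u'| + `|m%:R * v'| = m%:R by rewrite !normrM !normr_nat -mulrDr e2 mulr1.
move=> e2 e1; apply/andP; suff : `|m%:R * u - m%:R * u'| <= 2 /\ `|m%:R * v - m%:R * v'| <= 2.
  by case=> h1 h2; split; apply: scale.
have eb' : [|| k == m%:Z - 1, k == - m%:Z | (0 <= m%:R * v) == (0 <= m%:R * v')].
  rewrite !pmulr_rge0 //; move: eb; case: (k == _) => //=; case: (k == _) => //= ->.
  exact: eqxx.
move: ku ku' eb' e1 e2 => {eb}.
move: (m%:R * u) (m%:R * u') (m%:R * v) (m%:R * v') => U U' V V' kU kU' eb e1 e2.
split; first by rewrite ler_norml; lra.
case/or3P: eb => [/eqP kE|/eqP kE|/eqP sE].
- move: kU kU'; rewrite kE intrD /= => kU kU'.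
  have hU := ler_norm U; have hU' := ler_norm U'.
  rewrite (le_trans (ler_normB _ _)) //; lra.
- move: kU kU'; rewrite kE rmorphN /= => kU kU'.
  have hU := ler_norm (- U); have hU' := ler_norm (- U'); rewrite !normrN in hU hU'.
  rewrite (le_trans (ler_normB _ _)) //; lra.
- have h : `| `|U| - `|U'| | <= 1.
    by rewrite (le_trans (ler_dist_dist _ _)) // ler_norml; lra.
  suff : `|V - V'| = `| `|V| - `|V'| |.
    move=> ->; rewrite (_ : `|V| - `|V'| = - (`|U| - `|U'|)) ?normrN; lra.
  case: (ger0P V) sE => hV; case: (ger0P V') => hV' // _.
  by rewrite -opprB normrN opprK addrC.
Qed.

(** The circle has covering dimension one. Close directions have indices differing by at most one,
    so two of the three agree; with equal indices, away from the end sectors, opposite signs would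
    put the scaled second coordinates at least 2 apart. *)
Lemma sector_pigeonhole m y1 y2 y3 : (1 < m)%N ->
    0 < norm1 y1 -> 0 < norm1 y2 -> 0 < norm1 y3 ->
    `|direction y1 - direction y2| < m%:R^-1 ->
    `|direction y1 - direction y3| < m%:R^-1 ->
    `|direction y2 - direction y3| < m%:R^-1 ->
  [\/ sector m y1 = sector m y2, sector m y1 = sector m y3
     | sector m y2 = sector m y3].
Proof.
move=> m1.
have m0 : (0 : R) < m%:R by rewrite ltr0n ltnW.
have near_k y z : 0 < norm1 y -> 0 < norm1 z ->
    `|direction y - direction z| < m%:R^-1 -> sector_index m y <= sector_index m z + 1.
  move=> y0 z0; rewrite dist2_lt => /andP[h _].
  have [_ /andP[ky _] _] := sector_bounds m1 y0.
  have [/andP[_ yk] _ _] := sector_bounds m1 y0.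
  have [_ _ /orP[/eqP kz|kz]] := sector_bounds m1 z0; first by rewrite kz subrK; lia.
  have : m%:R * direction y 0 0 - m%:R * direction z 0 0 < 1.
    rewrite -mulrBr -[ltRHS](mulfV (lt0r_neq0 m0)) ltr_pM2l //.
    by rewrite (le_lt_trans (ler_norm _)).
  move=> hh; rewrite -ltzD1 -(ltr_int R) !intrD /=; lra.
have same_k y z : 0 < norm1 y -> 0 < norm1 z ->
    `|direction y - direction z| < m%:R^-1 -> sector_index m y = sector_index m z ->
    sector m y = sector m z.
  move=> y0 z0 d ek; rewrite /sector /= ek; congr pair.
  have [_ ky hy] := sector_bounds m1 y0; have [_ kz hz] := sector_bounds m1 z0.
  have [kr|/negbTE kr] := boolP (sector_index m z == m%:Z - 1); first by [].
  have [kl|/negbTE kl] := boolP (sector_index m z == - m%:Z); first by [].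
  have [kb _ _] := sector_bounds m1 z0.
  have kb' : - m%:Z + 1 <= sector_index m z <= m%:Z - 2 by lia.
  move: d; rewrite dist2_lt => /andP[_ d].
  have {d} d : `|m%:R * direction y 0 1 - m%:R * direction z 0 1| < 1.
    by rewrite -mulrBr normrM (gtr0_norm m0) -[ltRHS](mulfV (lt0r_neq0 m0)) ltr_pM2l.
  have big w : 0 < norm1 w -> sector_index m w = sector_index m z -> 1 <= `|m%:R * direction w 0 1|.
    move=> w0 kw; have [_ kw1 _] := sector_bounds m1 w0.
    have : `|m%:R * direction w 0 0| + `|m%:R * direction w 0 1| = m%:R.
      by rewrite !normrM !normr_nat -mulrDr -/(norm1 _) norm1_direction // mulr1.
    suff : `|m%:R * direction w 0 0| <= m%:R - 1 by lra.
    rewrite kw in kw1; case/andP: kb'; rewrite -2!(ler_int R) !intrD rmorphN /= => h1 h2.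
    rewrite ler_norml; lra.
  have := big _ y0 ek; have := big _ z0 erefl.
  rewrite -(pmulr_rge0 _ m0) -[in RHS](pmulr_rge0 _ m0).
  move: d; rewrite ltr_norml; case: (ger0P (_ * direction y 0 1));
    case: (ger0P (_ * direction z 0 1)) => //; lra.
move=> p1 p2 p3 d12 d13 d23.
have k12 := near_k _ _ p1 p2 d12; have k13 := near_k _ _ p1 p3 d13.
have k23 := near_k _ _ p2 p3 d23.
have sym (y z : plane R) : `|direction y - direction z| < m%:R^-1 ->
    `|direction z - direction y| < m%:R^-1.
  by rewrite distrC.
have k21 := near_k _ _ p2 p1 (sym _ _ d12); have k31 := near_k _ _ p3 p1 (sym _ _ d13).
have k32 := near_k _ _ p3 p2 (sym _ _ d23).
have : [\/ sector_index m y1 = sector_index m y2, sector_index m y1 = sector_index m y3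
     | sector_index m y2 = sector_index m y3].
  move: k12 k13 k23 k21 k31 k32.
  move: (sector_index m y1) (sector_index m y2) (sector_index m y3) => a b c.
  move=> *; suff : [|| a == b, a == c | b == c].
    by case/or3P => /eqP; [constructor 1|constructor 2|constructor 3].
  by lia.
by case=> /same_k h; [constructor 1|constructor 2|constructor 3]; apply: h.
Qed.

End Sectors.

(** * Invariance of domain *)

Section InvarianceOfDomain.
Context {R : realType}.

Lemma square_compact (c : plane R) (r : R) : compact (square c r).
Proof.
apply: bounded_closed_compact.
  exists (`|c| + r); split; first exact: num_real.
  move=> M /ltW cM x /= xc; apply: le_trans cM.
  by rewrite -[x](subrK c) addrC (le_trans (ler_normD _ _)) // lerD2l.
rewrite (_ : square c r = closed_ball_ Num.norm c r); first exact: closed_closed_ball_.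
by apply/seteqP; split=> x; rewrite /square /closed_ball_ /= distrC.
Qed.

(* The quadrant colouring of the square is transported by [f].  Around a hole
   [p] of the image near [f c] it is replaced by a colouring that is constant
   on thin sectors with apex [p] and agrees with the nearby quadrant colours on
   the outer side, so that no three colours meet. *)
Lemma invariance_of_domain (c : plane R) (r : R) (K : set (plane R))
    (f g : plane R -> plane R) :
  0 < r -> homeo_on (square c r) K f g -> interior K (f c).
Proof.
move=> r0 [cf cg fK gK]; apply: contrapT => nint.
have cptK : compact K.
  rewrite (_ : K = f @` square c r).
    exact: continuous_compact cf (@square_compact c r).
  by apply/seteqP; split=> [y /gK[? <-]|_ [x /fK[? _] <-]] //; exists (g y).
have Qc : square c r c by rewrite /square /= subrr normr0 ltW.
have inv e : 0 < e -> exists2 t, 0 < t & forall x y, square c r x -> square c r y ->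
    `|f x - f y| < t -> `|x - y| < e.
  move=> e0; have [t t0 tP] := compact_unif_cont cptK cg e0.
  exists t => // x y /fK[Kx ex] /fK[Ky ey] xy.
  by rewrite -ex -ey; apply: tP.
have unif := compact_unif_cont (@square_compact c r) cf.
(* The rim of the square is mapped at least [e] away from [f c], hence at least [eps = e / 2] away
   from the hole [p], which is [eps / 4]-close to [f c]. *)
have [e e0 eP] := inv r r0.
pose eps := e / 2; have eps0 : 0 < eps by rewrite divr_gt0.
have [p nKp pfc] : exists2 p, ~ K p & `|f c - p| < eps / 4.
  apply: contrapT => none; apply: nint; apply/nbhs_ballP.
  exists (eps / 4); rewrite /= ?divr_gt0 // => p; rewrite -ball_normE /= => pb.
  by apply: contrapT => nKp; apply: none; exists p.
have [rho rho0 rhoP] : exists2 rho, 0 < rho & forall x, square c r x -> rho <= norm1 (f x - p).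
  have : nbhs p (~` K).
    apply: open_nbhs_nbhs; split => //; apply: closed_openC.
    exact: compact_closed (@norm_hausdorff _ _) cptK.
  case/nbhs_ballP => rho /= rho0 rhoP; exists rho => // x /fK[Kx _].
  rewrite (le_trans _ (norm1_ge _)) // leNgt; apply/negP => h.
  by apply: (rhoP (f x)) => //; rewrite -ball_normE /= distrC.
(* Used in contrapositive: points mapped at least [eps] from [p] stay [d] away from [c], the only
   place where the three quadrant colours meet. *)
have [d d0 dP] : exists2 d, 0 < d & forall x, square c r x -> `|x - c| < d -> norm1 (f x - p) < eps.
  have e40 : 0 < eps / 4 by rewrite divr_gt0.
  have [d d0 dP] := unif _ e40; exists d => // x Qx xc.
  have h := dP _ _ Qx Qc xc.
  apply: le_lt_trans (norm1_le _) _.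
  have -> : f x - p = (f x - f c) + (f c - p) by rewrite addrA subrK.
  have := ler_normD (f x - f c) (f c - p); lra.
have d30 : 0 < d / 3 by rewrite divr_gt0.
have [t t0 tP] := inv _ d30.
have t60 : 0 < t / 6 by rewrite divr_gt0.
(* Sectors so thin that the angular error at radius [eps] is below [t / 2]; with a radial error
   [t / 3] and a step [t / 6] it adds up to the modulus [t] of the inverse map. *)
pose m := (Num.bound (4 * eps / t)).+2; have m1 : (1 < m)%N by [].
have m0 : (0 : R) < m%:R by rewrite ltr0n.
have mt : 2 * eps / m%:R < t / 2.
  have h : 0 <= 4 * eps / t by rewrite divr_ge0 ?mulr_ge0 // ltW.
  have : 4 * eps / t < m%:R by rewrite (lt_le_trans (archi_boundP h)) // ler_nat /m; lia.
  rewrite !ltr_pdivrMr // => h2; lra.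
have [h1 h10 h1P] := unif _ t60.
have rm0 : 0 < rho / (3 * m%:R) by rewrite divr_gt0 // mulr_gt0.
have [h2 h20 h2P] := unif _ rm0.
pose eta := Num.min (d / 3) (Num.min h1 h2).
have eta0 : 0 < eta by rewrite !lt_min d30 h10 h20.
pose N x := norm1 (f x - p).
(* Outer points whose image is [t / 6]-close to that of an inner point of sector [k]: the candidates
   from which sector [k] may borrow its colour. *)
pose ref k x' := [/\ square c r x', eps <= N x' & exists x2,
  [/\ square c r x2, N x2 < eps, sector m (f x2 - p) = k & `|f x' - f x2| < t / 6]].
pose chi0 (x : plane R) := (c 0 0 < x 0 0, c 0 1 < x 0 1).
(* Inner points of one sector all take the colour of the same chosen reference point; a sector
   without one gets the default, the colour of [c]. *)
pose chi x := if eps <= N x then chi0 x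
  else chi0 (xget c [set x' | ref (sector m (f x - p)) x']).
have bdry x : square c r x -> `|x - c| = r -> eps <= N x.
  move=> Qx xc; rewrite leNgt; apply/negP => h.
  have : `|x - c| < r.
    apply: eP => //.
    have := norm1_ge (f x - p); have := ler_distD p (f x) (f c); rewrite (distrC p).
    rewrite /N /eps in h pfc *; lra.
  by rewrite xc ltxx.
have edge x : square c r x -> (exists i, `|x 0 i - c 0 i| = r) -> chi x = chi0 x.
  move=> Qx [i xi]; rewrite /chi bdry //; apply/eqP; rewrite eq_le Qx /= -xi.
  have := lexx `|x - c|; rewrite [in X in X -> _]dist2_le => /andP[? ?].
  by case: (unliftP 0 i) => [j|] -> //; rewrite (ord1 j) (_ : lift _ _ = 1) //; apply: val_inj.
have [||||x [y [z [[cx cy cz] [Qx Qy Qz] [xy xz yz]]]]] :=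
    @square_tricolored R c r eta chi r0 eta0.
- move=> x Qx xE; rewrite edge //; first by rewrite /chi0 /colA /= xE ltrDl.
  by exists 0; rewrite xE addrAC subrr add0r gtr0_norm.
- move=> x Qx xE; rewrite edge //; first by rewrite /chi0 /colA /= xE -leNgt gerBl ltW.
  by exists 0; rewrite xE addrAC subrr add0r normrN gtr0_norm.
- move=> x Qx xE; rewrite edge //; first by rewrite /chi0 /colC /= xE ltrDl r0 andbF.
  by exists 1; rewrite xE addrAC subrr add0r gtr0_norm.
- move=> x Qx xE; rewrite edge //.
    by rewrite /chi0 /colB /= xE (ltNge _ (_ - _)) gerBl ltW // andbF.
  by exists 1; rewrite xE addrAC subrr add0r normrN gtr0_norm.
have far x' : square c r x' -> eps <= N x' -> d <= `|x' - c|.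
  by move=> Qx'; apply: contraTT; rewrite -!ltNge; apply: dP.
(* The A point lies across the vertical line through [c], the C point is not above the horizontal
   one; so the B point is within [d] of both lines, hence of [c], against [far]. *)
have no3 a b e' : square c r b -> eps <= N b -> `|a - b| < d -> `|b - e'| < d ->
    colA (chi0 a) -> colB (chi0 b) -> colC (chi0 e') -> False.
  move=> Qb Nb; have := far _ Qb Nb; rewrite leNgt !dist2_lt /colA /colB /colC /= -!leNgt.
  move=> + /andP[ab _] /andP[_ be] ca /andP[cb cb'] /andP[ce ce']; apply/negP; rewrite negbK.
  move: ab be; rewrite !ltr_norml; lra.
have outer w x' : square c r w -> square c r x' -> `|w - x'| < eta -> eps <= N w ->
    exists x'', [/\ square c r x'', eps <= N x'', chi x' = chi0 x'' & `|x'' - x'| < d / 3].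
  move=> Qw Qx' wx' Nw; have [Nx'|Nx'] := leP eps (N x').
    by exists x'; split => //; [rewrite /chi Nx' | rewrite subrr normr0].
  rewrite /chi leNgt Nx' /=.
  have wx1 : `|f w - f x'| < t / 6.
    by apply: h1P => //; rewrite (lt_le_trans wx') // /eta !ge_min lexx !orbT.
  have Rw : ref (sector m (f x' - p)) w by split => //; exists x'.
  have := @xgetPex _ c [set x' | ref _ x'] (ex_intro _ _ Rw).
  move: (xget c _) => x'' [Qx'' Nx'' [x2 [Qx2 Nx2 sec dx2]]].
  exists x''; split => //; apply: tP => //.
  have l1 := norm1_lip (f w - p) (f x' - p).
  have l2 := norm1_lip (f x'' - p) (f x2 - p).
  have eB (u v : plane R) : (u - p) - (v - p) = u - v by rewrite opprB addrA subrK.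
  rewrite !eB in l1 l2.
  have b1 := le_trans (ler_norm _) l1; have b2 := le_trans (ler_norm _) l2.
  rewrite /N in Nw Nx' Nx'' Nx2.
  have p1 : 0 < norm1 (f x' - p) := lt_le_trans rho0 (rhoP _ Qx').
  have p2 : 0 < norm1 (f x2 - p) := lt_le_trans rho0 (rhoP _ Qx2).
  have dd : `|direction (f x2 - p) - direction (f x' - p)| <= 2 / m%:R.
    exact: same_sector_close.
  have := @dist_direction _ eps (t / 3) (f x2 - p) (f x' - p) p2 p1; rewrite eB.
  have -> : eps - t / 3 <= norm1 (f x2 - p) <= eps by lra.
  have -> : eps - t / 3 <= norm1 (f x' - p) <= eps by lra.
  move=> /(_ isT isT) dist.
  have := ler_distD (f x2) (f x'') (f x').
  have : eps * `|direction (f x2 - p) - direction (f x' - p)| <= eps * (2 / m%:R).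
    by rewrite ler_pM2l.
  lra.
have etad : eta <= d / 3 by rewrite /eta !ge_min lexx.
(* One outer point [w] makes all three colours quadrant colours of outer points, each [d / 3]-close
   to the original; with [eta <= d / 3] these are within [d] of each other. *)
have contra w : square c r w -> eps <= N w -> `|w - x| < eta -> `|w - y| < eta ->
    `|w - z| < eta -> False.
  move=> Qw Nw wx wy wz.
  have [x'' [Qx'' Nx'' ex dx]] := outer _ _ Qw Qx wx Nw.
  have [y'' [Qy'' Ny'' ey dy]] := outer _ _ Qw Qy wy Nw.
  have [z'' [Qz'' Nz'' ez dz]] := outer _ _ Qw Qz wz Nw.
  rewrite ex in cx; rewrite ey in cy; rewrite ez in cz.
  apply: no3 Qy'' Ny'' _ _ cx cy cz.
    have := ler_distD x x'' y''; have := ler_distD y x y''; rewrite (distrC y y''); lra.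
  have := ler_distD y y'' z''; have := ler_distD z y z''; rewrite (distrC z z''); lra.
have self (u : plane R) : `|u - u| < eta by rewrite subrr normr0.
have [Nx|Nx] := leP eps (N x); first exact: (contra x).
have [Ny|Ny] := leP eps (N y); first by apply: (contra y) => //; rewrite distrC.
have [Nz|Nz] := leP eps (N z); first by apply: (contra z) => //; rewrite distrC.
(* All three points are now inner: their directions from [p] are within [1 / m], so two of them
   share a sector and hence a colour. *)
have dir u v : square c r u -> square c r v -> `|u - v| < eta ->
    `|direction (f u - p) - direction (f v - p)| < m%:R^-1.
  move=> Qu Qv uv; apply: le_lt_trans (direction_lip rho0 (rhoP _ Qu) (rhoP _ Qv)) _.
  rewrite opprB addrA subrK.
  have : `|f u - f v| < rho / (3 * m%:R).
    by apply: h2P => //; rewrite (lt_le_trans uv) // /eta !ge_min lexx !orbT.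
  rewrite ltr_pdivrMr // ltr_pdivlMr ?mulr_gt0 // => h.
  rewrite (mulrC _^-1) ltr_pdivlMr // (_ : _ * _ * _ = `|f u - f v| * (3 * m%:R)) //.
  ring.
have pos u : square c r u -> 0 < norm1 (f u - p).
  by move=> Qu; apply: lt_le_trans rho0 (rhoP _ Qu).
move: cx cy cz; rewrite /chi !leNgt Nx Ny Nz /=.
case: (sector_pigeonhole m1 (pos _ Qx) (pos _ Qy) (pos _ Qz) (dir _ _ Qx Qy xy)
  (dir _ _ Qx Qz xz) (dir _ _ Qy Qz yz)) => ->;
  rewrite /colA /colB /colC.
- by move=> h /andP[/negP].
- by move=> h _ /andP[/negP].
- by move=> _ /andP[_ h] /andP[_ /negP].
Qed.

End InvarianceOfDomain.

(** * Disks and Jordan curves *)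

Section Homeo.
Context {X Y : topologicalType}.
Implicit Types (A : set X) (B : set Y).

Lemma homeo_on_image A B f g : homeo_on A B f g -> f @` A = B.
Proof.
move=> [_ _ fK gK]; apply/seteqP; split=> [_ [x /fK[? _] <-] //|y /gK[? <-]].
by exists (g y).
Qed.

Lemma homeo_on_sub A A' B f g :
  A' `<=` A -> homeo_on A B f g -> homeo_on A' (f @` A') f g.
Proof.
move=> A'A h; have fAB := homeo_on_image h; case: h => [cf cg fK gK].
split; first exact: continuous_subspaceW cf.
- apply: continuous_subspaceW cg => _ [x /A'A Ax <-].
  by have [] := fK x Ax.
- by move=> x A'x; split; [exists x | have [] := fK x (A'A _ A'x)].
- by move=> _ [x A'x <-]; have [_ ->] := fK x (A'A _ A'x).
Qed.

Lemma homeo_on_sym A B f g : homeo_on A B f g -> homeo_on B A g f.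
Proof. by case=> cf cg fK gK; split. Qed.

Lemma homeo_on_compact A B f g : homeo_on A B f g -> compact A -> compact B.
Proof.
move=> h cA; rewrite -(homeo_on_image h); case: h => cf _ _ _.
exact: continuous_compact.
Qed.

Lemma within_comp_continuous (Z : topologicalType) A B (f : X -> Y) (g : Y -> Z) :
  {within A, continuous f} -> (forall x, A x -> B (f x)) ->
  {within B, continuous g} -> {within A, continuous (g \o f)}.
Proof.
move=> /subspace_continuousP cf fAB /subspace_continuousP cg.
apply/subspace_continuousP => x Ax; apply: cvg_comp (cg _ (fAB _ Ax)).
move=> W WB; have := cf x Ax _ WB; rewrite /nbhs /= /within /=.
by apply: filterS => y h Ay; apply: h => //; apply: fAB.
Qed.

End Homeo.

Section Connected.
Context {R : realType} {V : normedModType R}.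

Lemma star_connected (A : set V) (c : V) :
  (forall x, A x -> forall t : R, 0 <= t <= 1 -> A (c + t *: (x - c))) -> connected A.
Proof.
move=> starA; have [[a Aa]|A0] := pselect (A !=set0); last first.
  by rewrite (_ : A = set0); [exact: connected0 | apply/nonemptyPn].
have Ac : A c by have := starA _ Aa 0; rewrite scale0r addr0; apply; rewrite lexx ler01.
pose seg x := (fun t : R => c + t *: (x - c)) @` `[0, 1].
have -> : A = \bigcup_(x in A) seg x.
  apply/seteqP; split=> [x Ax|_ [x Ax [t t01 <-]]]; last first.
    by apply: starA => //; move: t01; rewrite /= in_itv.
  exists x => //; exists 1; first by rewrite /= in_itv /= ler01 lexx.
  by rewrite scale1r addrC subrK.
apply: bigcup_connected => [|x Ax].
  exists c => x _; exists 0; first by rewrite /= in_itv /= lexx ler01.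
  by rewrite scale0r addr0.
apply: connected_continuous_connected; first exact: segment_connected.
apply: continuous_subspaceT => t.
by apply: cvgD; [exact: cvg_cst | apply: cvgZr_tmp; exact: cvg_id].
Qed.

Lemma ball_connected (c : V) (r : R) : connected (ball c r).
Proof.
apply: (@star_connected _ c) => x; rewrite -ball_normE /= => cx t /andP[t0 t1].
rewrite opprD addrA subrr sub0r normrN normrZ ger0_norm // distrC.
apply: le_lt_trans cx; rewrite -[leRHS]mul1r distrC; exact: ler_wpM2r.
Qed.

Lemma open_connected_component (A : set V) x : open A -> open (connected_component A x).
Proof.
move=> oA; rewrite openE => y Ay.
have : nbhs y A by apply: open_nbhs_nbhs; split=> //; exact: connected_component_sub Ay.
case/nbhs_ballP => r /= r0 rA; apply/nbhs_ballP; exists r => // z rz.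
apply: connected_component_trans Ay _.
by apply: (connected_component_max _ rA (@ball_connected y r) rz); exact: ballxx.
Qed.

(** Off [bd A], the interior and the closure of [A] have the same trace on [C], which is therefore
    open and closed in [C]. *)
Lemma connected_boundary (A C : set V) : connected C -> C `&` interior A !=set0 ->
  C `&` bd A = set0 -> C `<=` interior A.
Proof.
move=> cC Ci Cb.
have -> : C = C `&` interior A; last by move=> ? [].
symmetry; apply: cC => //.
  by exists (interior A); first exact: open_interior.
exists (closure A); first exact: closed_closure.
apply/seteqP; split=> x [Cx Ax]; split => //.
  by apply: subset_closure; exact: interior_subset.
apply: contrapT => nint; have : (C `&` bd A) x by split.
by rewrite Cb.
Qed.

End Connected.

Section Disks.
Context {R : realType}.
Implicit Types (x y z : plane R) (K : set (plane R)).

Definition open_disk : set (plane R) := [set z | sqnorm z < 1].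

Lemma sqnormZ (a : R) z : sqnorm (a *: z) = a ^+ 2 * sqnorm z.
Proof. by rewrite !sqnormE !mxE; ring. Qed.

Lemma sqnorm_continuous : continuous (@sqnorm R).
Proof.
have -> : @sqnorm R = fun z : plane R => z 0 0 * z 0 0 + z 0 1 * z 0 1.
  by apply/funext => z; rewrite sqnormE !expr2.
have c i : continuous (fun z : plane R => z 0 i) by exact: coord_continuous.
move=> x; exact: cvgD (cvgM (c 0 x) (c 0 x)) (cvgM (c 1 x) (c 1 x)).
Qed.

Lemma open_disk_open : open open_disk.
Proof.
rewrite (_ : open_disk = @sqnorm R @^-1` [set a | a < 1]) //.
by apply: open_comp => // x _; exact: sqnorm_continuous.
Qed.

Lemma closed_disk_compact : compact (@closed_disk R).
Proof.
apply: (subclosed_compact _ (@square_compact R 0 1)).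
  rewrite (_ : @closed_disk R = @sqnorm R @^-1` [set a | a <= 1]) //.
  by apply: closed_comp => // x _; exact: sqnorm_continuous.
move=> x; rewrite /closed_disk /square /= subr0 sqnormE norm2_le => h.
have sq (a : R) : a ^+ 2 <= 1 -> `|a| <= 1 by rewrite -real_normK ?num_real // expr_le1.
have := sqr_ge0 (x 0 0); have := sqr_ge0 (x 0 1).
by move=> h0 h1; apply/andP; split; apply: sq; lra.
Qed.

Lemma circle_compact : compact (@unit_circle R).
Proof.
apply: (subclosed_compact _ closed_disk_compact).
  rewrite (_ : @unit_circle R = @sqnorm R @^-1` [set 1]) //.
  by apply: closed_comp => // x _; exact: sqnorm_continuous.
by move=> x; rewrite /unit_circle /closed_disk /= => ->.
Qed.

Lemma open_disk_connected : connected open_disk.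
Proof.
apply: (@star_connected _ _ _ 0) => x; rewrite /open_disk /= => x1 t /andP[t0 t1].
rewrite add0r subr0 sqnormZ; apply: le_lt_trans x1.
rewrite -[leRHS]mul1r ler_wpM2r ?exprn_ile1 // sqnormE addr_ge0 ?sqr_ge0 //.
Qed.

Lemma interior_homeo_point (A B : set (plane R)) f g x : homeo_on A B f g ->
  interior A x -> interior B (f x).
Proof.
move=> h /nbhs_ballP[e /= e0 eA].
have sA : square x (e / 2) `<=` A.
  move=> y; rewrite /square /= => yx; apply: eA; rewrite -ball_normE /= distrC.
  by apply: le_lt_trans yx _; rewrite ltr_pdivrMr // ltr_pMr // ltr1n.
have e20 : 0 < e / 2 by rewrite divr_gt0.
have := invariance_of_domain e20 (homeo_on_sub sA h).
apply: interiorS => _ [y /sA Ay <-].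
by case: h => _ _ fK _; have [] := fK y Ay.
Qed.

Lemma closed_disk_interior x : interior (@closed_disk R) x -> open_disk x.
Proof.
move=> ix; have := interior_subset ix; rewrite /open_disk /closed_disk /= le_eqVlt.
case/orP => // /eqP x1; exfalso.
have /nbhs_ballP[e /= e0 eD] := ix.
pose s := e / (`|x| + 1); have nx : 0 < `|x| + 1 by rewrite ltr_wpDl.
have s0 : 0 < s by rewrite divr_gt0.
have : @closed_disk R ((1 + s) *: x).
  apply: eD; rewrite -ball_normE /= scalerDl scale1r opprD addrA subrr sub0r normrN.
  by rewrite normrZ gtr0_norm // /s mulrAC ltr_pdivrMr // ltr_pM2l // ltrDl.
rewrite /closed_disk /= sqnormZ x1 mulr1 => h.
have : 1 < (1 + s) ^+ 2 by rewrite expr_gt1 // ?ltrDl // addr_ge0 // ltW.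
lra.
Qed.

Lemma bd_closed (X : topologicalType) (A : set X) : closed A -> bd A = A `\` interior A.
Proof. by move=> cA; rewrite /bd -(iffLR (closure_id _) cA). Qed.

Lemma plane_compact_closed K : compact K -> closed K.
Proof. exact: compact_closed (@norm_hausdorff _ _). Qed.

Section EmbeddedDisk.
Context (K : set (plane R)) (f g : plane R -> plane R).
Context (h : homeo_on (@closed_disk R) K f g).

Lemma disk_compact : compact K.
Proof. exact: homeo_on_compact h closed_disk_compact. Qed.

Lemma disk_closed : closed K.
Proof. exact: plane_compact_closed disk_compact. Qed.

(** Both inclusions are invariance of domain, for the homeomorphism and for its inverse. *)
Lemma disk_interior : interior K = f @` open_disk.
Proof.
apply/seteqP; split=> [y iy|_ [x x1 <-]].
  have Ky := interior_subset iy.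
  have /closed_disk_interior := interior_homeo_point (homeo_on_sym h) iy.
  by case: h => _ _ _ /(_ _ Ky)[_ fgy] gy; exists (g y).
apply: (interior_homeo_point h); apply: (@interiorS _ open_disk).
  by move=> z; rewrite /open_disk /closed_disk /= => /ltW.
suff -> : interior open_disk = open_disk by [].
by apply/interior_id; exact: open_disk_open.
Qed.

Lemma disk_boundary : bd K = f @` @unit_circle R.
Proof.
rewrite (bd_closed disk_closed) disk_interior; case: h => _ _ fK gK.
apply/seteqP; split=> [y [Ky nfy]|_ [x x1 <-]].
  have [Dg e] := gK _ Ky; exists (g y) => //.
  move: Dg; rewrite /closed_disk /unit_circle /= le_eqVlt => /orP[/eqP //|lt1].
  by exfalso; apply: nfy; exists (g y).
have Dx : @closed_disk R x by rewrite /closed_disk /= x1.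
have [Kx e] := fK _ Dx; split => // -[z z1 ez].
have Dz : @closed_disk R z by rewrite /closed_disk /= ltW.
have [_ e'] := fK _ Dz; move: z1; rewrite /open_disk /= -e' ez e x1 ltxx //.
Qed.

Lemma disk_interior_connected : connected (interior K).
Proof.
rewrite disk_interior; apply: connected_continuous_connected open_disk_connected _.
case: h => cf _ _ _; apply: continuous_subspaceW cf => z.
by rewrite /open_disk /closed_disk /= => /ltW.
Qed.

Lemma disk_regular : K `<=` closure (interior K).
Proof.
move=> y Ky; have [cf _ fK gK] := h; have [Dx <-] := gK _ Ky.
set x := g y in Dx *; move=> B /nbhs_ballP[e /= e0 eB].
have /within_continuousP/(_ _ Dx _ e0)[d d0 dP] := cf.
(* Pulling [x] towards the centre by the factor [1 - s] lands in the open disk; the bound 1/2 keeps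
   this factor positive, the other keeps the displacement below [d]. *)
pose s := Num.min (2^-1) (d / (`|x| + 1)); have nx : 0 < `|x| + 1 by rewrite ltr_wpDl.
have s0 : 0 < s by rewrite lt_min invr_gt0 ltr0n divr_gt0.
have s1 : s <= 2^-1 by rewrite /s ge_min lexx.
have sd : s <= d / (`|x| + 1) by rewrite /s ge_min lexx orbT.
have o1 : open_disk ((1 - s) *: x).
  move: Dx; rewrite /open_disk /closed_disk /= sqnormZ => Dx.
  have p0 : 0 <= sqnorm x by rewrite sqnormE addr_ge0 ?sqr_ge0.
  have p1 : (1 - s) ^+ 2 < 1 by rewrite expr_lt1 //; lra.
  by rewrite (le_lt_trans _ p1) // -[leRHS]mulr1 ler_wpM2l // sqr_ge0.
exists (f ((1 - s) *: x)); split; first by rewrite disk_interior; exists ((1 - s) *: x).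
apply: eB; rewrite -ball_normE /=; apply: dP.
  by move: o1; rewrite /open_disk /closed_disk /= => /ltW.
rewrite scalerBl scale1r opprB addrC subrK normrZ gtr0_norm //.
have : s * (`|x| + 1) <= d by rewrite -ler_pdivlMr.
lra.
Qed.

Lemma disk_interior_nonempty : interior K !=set0.
Proof.
by exists (f 0); rewrite disk_interior; exists 0 => //; rewrite /open_disk /= sqnormE !mxE; lra.
Qed.

End EmbeddedDisk.

(* A non-surjective injection followed by stereographic projection would be an
   injection of the circle into the line; it takes equal values at two antipodal
   points by the intermediate value theorem. *)
Lemma circle_injection_onto (phi : plane R -> plane R) :
    {within @unit_circle R, continuous phi} ->
    (forall x, @unit_circle R x -> @unit_circle R (phi x)) ->
    (forall x y, @unit_circle R x -> @unit_circle R y -> phi x = phi y -> x = y) ->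
  forall p, @unit_circle R p -> exists2 x, @unit_circle R x & phi x = p.
Proof.
move=> cphi phiS inj p p1; apply: contrapT => none.
(* [dot] and [cross] are coordinates in an orthonormal frame with first axis [p]; [ster] projects
   the circle from [p] to a line. *)
pose dot (z : plane R) := z 0 0 * p 0 0 + z 0 1 * p 0 1.
pose cross (z : plane R) := z 0 0 * p 0 1 - z 0 1 * p 0 0.
pose ster z := cross z / (1 - dot z).
have dot1 z : @unit_circle R z -> z <> p -> dot z < 1.
  move: p1; rewrite /unit_circle /= !sqnormE /dot => p1 z1 zp.
  rewrite ltNge; apply/negP => dz; apply: zp.
  have : (z 0 0 - p 0 0) ^+ 2 + (z 0 1 - p 0 1) ^+ 2 = 0.
    apply/eqP; rewrite eq_le addr_ge0 ?sqr_ge0 // andbT; nra.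
  move/eqP; rewrite paddr_eq0 ?sqr_ge0 // !sqrf_eq0 !subr_eq0 => /andP[/eqP e0 /eqP e1].
  exact: row2P.
have crossdot z : @unit_circle R z -> cross z ^+ 2 + dot z ^+ 2 = 1.
  move: p1; rewrite /unit_circle /= !sqnormE => p1 z1.
  by rewrite /cross /dot -[RHS](mulr1 1) -{1}z1 -p1; ring.
have sterI z w : @unit_circle R z -> @unit_circle R w -> dot z < 1 -> dot w < 1 ->
    ster z = ster w -> z = w.
  move=> z1 w1 dz dw; have := crossdot _ z1; have := crossdot _ w1.
  have nz v : dot v < 1 -> 1 - dot v != 0 by move=> ?; rewrite subr_eq0 gt_eqF.
  rewrite /ster => cw cz /eqP; rewrite eqr_div ?nz // => /eqP e.
  have ed : dot z = dot w.
    have e2 : (cross z * (1 - dot w)) ^+ 2 = (cross w * (1 - dot z)) ^+ 2 by rewrite e.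
    have : (1 - dot z) * (1 - dot w) * (dot z - dot w) = 0.
      rewrite !exprMn in e2.
      have ez : cross z ^+ 2 = 1 - dot z ^+ 2 by lra.
      have ew : cross w ^+ 2 = 1 - dot w ^+ 2 by lra.
      rewrite ez ew in e2; lra.
    by move/eqP; rewrite !mulf_eq0 (negbTE (nz _ dz)) (negbTE (nz _ dw)) /= subr_eq0 => /eqP.
  have ec : cross z = cross w.
    by move: e; rewrite ed => /mulIf; apply; exact: nz.
  have pp : p 0 0 ^+ 2 + p 0 1 ^+ 2 = 1 by move: p1; rewrite /unit_circle /= sqnormE.
  have rec0 (v : plane R) : v 0 0 = dot v * p 0 0 + cross v * p 0 1.
    by rewrite -[LHS]mulr1 -pp /dot /cross; ring.
  have rec1 (v : plane R) : v 0 1 = dot v * p 0 1 - cross v * p 0 0.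
    by rewrite -[LHS]mulr1 -pp /dot /cross; ring.
  by apply: row2P; [rewrite (rec0 z) (rec0 w) | rewrite (rec1 z) (rec1 w)]; rewrite ed ec.
have phip x : @unit_circle R x -> dot (phi x) < 1.
  by move=> x1; apply: dot1 (phiS _ x1) _ => e; apply: none; exists x.
have cster : {within @unit_circle R, continuous (ster \o phi)}.
  apply: (@within_comp_continuous _ _ _ _ [set z | dot z < 1]) => //.
  apply: continuous_in_subspaceT => z; rewrite inE /= => dz.
  have co i : continuous (fun v : plane R => v 0 i) by exact: coord_continuous.
  have c i a : {for z, continuous (fun v : plane R => v 0 i * a)}.
    exact: cvgM (co i z) (cvg_cst a).
  have cc : {for z, continuous cross} by exact: cvgB (c 0 (p 0 1)) (c 1 (p 0 0)).
  have cd : {for z, continuous (fun v => 1 - dot v)}.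
    have cd : {for z, continuous dot} by exact: cvgD (c 0 (p 0 0)) (c 1 (p 0 1)).
    have c1 : {for z, continuous (fun _ : plane R => 1 : R)} by exact: cst_continuous.
    exact: cvgB c1 cd.
  have nz : 1 - dot z != 0 by rewrite subr_eq0 gt_eqF.
  exact: cvgM cc (cvgV nz cd).
(* The upper half circle; its two ends are antipodal, so the difference of the values at antipodal
   points takes opposite values at them. *)
pose q (t : R) := vec2 t (Num.sqrt (1 - t ^+ 2)).
have q1 t : `[-1, 1]%classic t -> @unit_circle R (q t).
  rewrite /= in_itv /= => /andP[t0 t1].
  rewrite /unit_circle /= sqnormE vec20 vec21 sqr_sqrtr; first by rewrite addrC subrK.
  nra.
have qN1 t : `[-1, 1]%classic t -> @unit_circle R (- q t).
  by move=> /q1; rewrite /unit_circle /= !sqnormE !mxE !sqrrN.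
have cq : continuous q.
  have -> : q = fun t => t *: vec2 1 0 + Num.sqrt (1 - t ^+ 2) *: vec2 0 1.
    by apply/funext => t; apply: row2P; rewrite !mxE /= !(mulr0, mulr1, addr0, add0r).
  have cs : continuous (fun t : R => 1 - t ^+ 2).
    have c1 : continuous (fun _ : R => 1 : R) by exact: cst_continuous.
    have c2 : continuous (fun t : R => t ^+ 2) by exact: exprn_continuous.
    move=> t; exact: cvgB (c1 t) (c2 t).
  have csq : continuous (fun t : R => Num.sqrt (1 - t ^+ 2)).
    by move=> t; apply: continuous_comp; [exact: cs | exact: sqrt_continuous].
  by move=> t; apply: cvgD; apply: cvgZr_tmp; [exact: cvg_id | exact: csq].
have cF : {within `[-1, 1], continuous (fun t => ster (phi (q t)) - ster (phi (- q t)))}.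
  move=> t; apply: cvgB.
    apply: (@within_comp_continuous _ _ _ _ (@unit_circle R) q (ster \o phi)) => //.
    exact: continuous_subspaceT.
  apply: (@within_comp_continuous _ _ _ _ (@unit_circle R) (fun t => - q t) (ster \o phi)) => //.
  by apply: continuous_subspaceT => t'; apply: cvgN; exact: cq.
have q1E : q 1 = vec2 1 0 by rewrite /q expr1n subrr sqrtr0.
have qN1E : q (-1) = - q 1.
  rewrite q1E /q sqrrN expr1n subrr sqrtr0.
  by apply: row2P; rewrite !mxE //= oppr0.
have [||t t01] := IVT (v := 0) (_ : -1 <= 1 :> R) cF; first lra.
  rewrite qN1E opprK.
  move: (ster (phi (q 1))) (ster (phi (- q 1))) => a b.
  by rewrite ge_min le_max; case: (leP a b) => ab; lra.
move/eqP; rewrite subr_eq0 => /eqP /(sterI _ _ (phiS _ (q1 _ t01)) (phiS _ (qN1 _ t01))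
  (phip _ (q1 _ t01)) (phip _ (qN1 _ t01))) /(inj _ _ (q1 _ t01) (qN1 _ t01)) e.
have e0 : q t 0 0 = 0 by have := congr1 (fun v : plane R => v 0 0) e; rewrite [in RHS]mxE; lra.
have e1 : q t 0 1 = 0 by have := congr1 (fun v : plane R => v 0 1) e; rewrite [in RHS]mxE; lra.
by move: (q1 _ t01); rewrite /unit_circle /= sqnormE e0 e1; lra.
Qed.

Lemma jordan_curve_compact (J : set (plane R)) : jordan_curve J -> compact J.
Proof. by case=> f [g h]; exact: homeo_on_compact h circle_compact. Qed.

Lemma jordan_curve_closed (J : set (plane R)) : jordan_curve J -> closed J.
Proof. by move=> /jordan_curve_compact; exact: plane_compact_closed. Qed.

Lemma jordan_curve_nonempty (J : set (plane R)) : jordan_curve J -> J !=set0.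
Proof.
case=> f [g [_ _ fK _]]; have c1 : @unit_circle R (vec2 1 0).
  by rewrite /unit_circle /= sqnormE vec20 vec21 expr1n expr0n addr0.
by have [] := fK _ c1; exists (f (vec2 1 0)).
Qed.

(** Through the parametrizations the inclusion becomes a continuous injection of the circle into
    itself, which is onto. *)
Lemma jordan_curve_subset_eq (J J' : set (plane R)) :
  jordan_curve J -> jordan_curve J' -> J `<=` J' -> J = J'.
Proof.
move=> [f [g [cf cg fK gK]]] [f' [g' [cf' cg' fK' gK']]] JJ'.
apply/seteqP; split=> // y J'y.
have [c1 e1] := gK' _ J'y.
have [||x y' Cx Cy' /= e|x Cx ex] := @circle_injection_onto (g' \o f) _ _ _ _ c1.
- apply: within_comp_continuous cf _ cg' => x /fK[Jx _]; exact: JJ'.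
- by move=> x /fK[/JJ' /gK'[]].
- have [Jx ex] := fK _ Cx; have [Jy' ey'] := fK _ Cy'.
  rewrite -ex -ey'; congr g.
  have [_ <-] := gK' _ (JJ' _ Jx); have [_ <-] := gK' _ (JJ' _ Jy').
  by rewrite e.
- have [Jx _] := fK _ Cx; have [_ e2] := gK' _ (JJ' _ Jx).
  by rewrite -e1 -ex /= e2.
Qed.

Lemma inside_open (J : set (plane R)) : closed J -> open (inside J).
Proof.
move=> cJ; rewrite openE => z [nJz bz].
have oC := open_connected_component z (closed_openC cJ).
have zC : connected_component (~` J) z z by exact: connected_component_refl.
apply: filterS (open_nbhs_nbhs (conj oC zC)) => y Cy; split.
  exact: connected_component_sub Cy.
by rewrite -(same_connected_component Cy).
Qed.

Lemma bd_enclosed_sub (J : set (plane R)) : closed (enclosed J) -> closed J ->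
  bd (enclosed J) `<=` J.
Proof.
move=> cE cJ; rewrite bd_closed // => z [[//|iz] nint]; exfalso; apply: nint.
apply: (@interiorS _ (inside J)); first by move=> y; right.
suff -> : interior (inside J) = inside J by [].
by apply/interior_id; exact: inside_open.
Qed.

(** The boundary of a disk is a Jordan curve, and here it lies in [J] because [inside J] is open; a
    Jordan curve inside [J] is all of [J]. *)
Lemma bd_enclosed (J : set (plane R)) : jordan_curve J ->
  homeomorphic (@closed_disk R) (enclosed J) -> bd (enclosed J) = J.
Proof.
move=> jJ [f [g h]]; apply: jordan_curve_subset_eq => //.
  exists f, g; rewrite (disk_boundary h); apply: homeo_on_sub h => z.
  by rewrite /unit_circle /closed_disk /= => ->.
apply: bd_enclosed_sub; last exact: jordan_curve_closed.
exact: disk_closed h.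
Qed.

End Disks.

(** * Translations and dilations *)

Section ImageHomeo.
Context {X : topologicalType} (f g : X -> X).
Context (cf : continuous f) (cg : continuous g) (fK : cancel f g) (gK : cancel g f).
Implicit Types A : set X.

Lemma image_preimage_can A : f @` A = g @^-1` A.
Proof.
apply/seteqP; split=> [_ [x Ax <-]|y Ay]; first by rewrite /= fK.
by exists (g y).
Qed.

Lemma image_interior A : interior (f @` A) = f @` interior A.
Proof.
apply/seteqP; split=> [y iy|].
  exists (g y) => //; apply: (@interiorS _ (f @^-1` interior (f @` A))).
    move=> z /= /interior_subset [w Aw /(congr1 g)]; rewrite !fK => <- //.
  suff -> : interior (f @^-1` interior (f @` A)) = f @^-1` interior (f @` A) by rewrite /= gK.
  by apply/interior_id; apply: open_comp => [? _|]; [exact: cf | exact: open_interior].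
rewrite !image_preimage_can; have o : open (g @^-1` interior A).
  by apply: open_comp => [? _|]; [exact: cg | exact: open_interior].
move/interior_id: (o) => <-; apply: interiorS.
by move=> y /= /interior_subset.
Qed.

Lemma image_setC A : f @` (~` A) = ~` (f @` A).
Proof. by rewrite !image_preimage_can. Qed.

Lemma image_closure A : closure (f @` A) = f @` closure A.
Proof.
apply: setC_inj; rewrite -interiorC -image_setC image_interior interiorC.
by rewrite image_setC.
Qed.

Lemma image_bd A : bd (f @` A) = f @` bd A.
Proof.
rewrite /bd image_closure image_interior !image_preimage_can.
by apply/seteqP; split.
Qed.

Lemma image_component_sub A x :
  f @` connected_component A x `<=` connected_component (f @` A) (f x).
Proof.
have [Ax|nAx] := pselect (A x); last first.
  by rewrite connected_component_out // image_set0.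
apply: connected_component_max.
- by exists x => //; exact: connected_component_refl.
- by apply: image_subset; exact: connected_component_sub.
- apply: connected_continuous_connected; first exact: component_connected.
  exact: continuous_subspaceT.
Qed.

End ImageHomeo.

Section ShiftScale.
Context {R : realType}.
Implicit Types (x y z v : plane R) (A B J : set (plane R)).

Lemma shift_continuous x : continuous (fun z : plane R => z + x).
Proof.
have c1 : continuous (fun _ : plane R => x) by exact: cst_continuous.
by move=> z; exact: cvgD (@cvg_id _ _) (c1 z).
Qed.

Lemma shift_setE x A z : shift_set x A z = A (z - x).
Proof.
apply/propext; split=> [[w Aw <-]|Az]; first by rewrite addrK.
by exists (z - x) => //; rewrite subrK.
Qed.

Lemma shift_setD x y A : shift_set x (shift_set y A) = shift_set (x + y) A.
Proof. by apply/seteqP; split=> z; rewrite !shift_setE opprD addrA. Qed.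

Lemma shift_set0 A : shift_set 0 A = A.
Proof. by apply/seteqP; split=> z; rewrite shift_setE subr0. Qed.

Lemma shift_interior x A : interior (shift_set x A) = shift_set x (interior A).
Proof.
by apply: (@image_interior _ (fun z => z + x) (fun z => z - x));
  [exact: shift_continuous | exact: shift_continuous | exact: addrK | exact: subrK].
Qed.

Lemma shift_bd x A : bd (shift_set x A) = shift_set x (bd A).
Proof.
by apply: (@image_bd _ (fun z => z + x) (fun z => z - x));
  [exact: shift_continuous | exact: shift_continuous | exact: addrK | exact: subrK].
Qed.

Lemma shift_homeomorphic (X : topologicalType) (A : set X) x B :
  homeomorphic A B -> homeomorphic A (shift_set x B).
Proof.
move=> [f [g [cf cg fK gK]]].
exists (fun a : X => (f a : plane R) + x), (fun z : plane R => g (z - x)); split.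
- have cs : {within setT, continuous (fun z : plane R => z + x)}.
    by apply: continuous_subspaceT; exact: shift_continuous.
  have h := @within_comp_continuous _ _ _ A setT f (fun z : plane R => z + x) cf (fun _ _ => I) cs.
  exact: h.
- have cs : {within shift_set x B, continuous (fun z : plane R => z - x)}.
    by apply: continuous_subspaceT; exact: shift_continuous.
  apply: (within_comp_continuous cs _ cg) => z.
  by rewrite shift_setE.
- by move=> a Aa; have [Bf e] := fK _ Aa; rewrite shift_setE addrK.
- by move=> b; rewrite shift_setE => Bb; have [Ag ->] := gK _ Bb; rewrite subrK.
Qed.

Lemma shift_inside x J : inside (shift_set x J) = shift_set x (inside J).
Proof.
suff sub y K : shift_set y (inside K) `<=` inside (shift_set y K).
  apply/seteqP; split; last exact: sub.
  have := @sub (- x) (shift_set x J); rewrite shift_setD addNr shift_set0 => h z iz.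
  by rewrite shift_setE; apply: h; rewrite shift_setE opprK subrK.
move=> z; rewrite shift_setE => -[nK [M [Mr bM]]]; split; first by rewrite shift_setE.
exists (M + `|y|); split; first by rewrite num_real.
move=> N MN w Cw; have : connected_component (~` K) (z - y) (w - y).
  have -> : ~` K = shift_set (- y) (~` shift_set y K).
    by apply/seteqP; split=> u; rewrite shift_setE /= shift_setE opprK addrK.
  have := @image_component_sub _ (fun u : plane R => u - y)
    (@shift_continuous (- y)) (~` shift_set y K) z.
  by apply; exists w.
have MN' : M < N - `|y| by rewrite ltrBrDr.
move/(bM _ MN') => /= h; rewrite -[w](subrK y) (le_trans (ler_normD _ _)) //.
by rewrite -lerBrDr.
Qed.

Lemma shift_setU x A B : shift_set x (A `|` B) = shift_set x A `|` shift_set x B.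
Proof. by apply/seteqP; split=> z; rewrite /setU /= !shift_setE. Qed.

Lemma shift_enclosed x J : enclosed (shift_set x J) = shift_set x (enclosed J).
Proof. by rewrite /enclosed shift_inside shift_setU. Qed.

(** A point outside the square escapes along the ray from [c] through it without meeting [J], so its
    component is unbounded. *)
Lemma enclosed_square c (r : R) J : 0 <= r -> J `<=` square c r ->
  enclosed J `<=` square c r.
Proof.
move=> r0 Jr u [/Jr //|[nJu [M [_ bM]]]]; rewrite /square /= leNgt; apply/negP => ur.
have uc0 : 0 < `|u - c| := le_lt_trans r0 ur.
pose ray := [set z | exists2 s : R, 1 <= s & z = c + s *: (u - c)].
have rayC : ray `<=` connected_component (~` J) u.
  apply: connected_component_max.
  - by exists 1; rewrite // scale1r addrC subrK.
  - move=> _ [s s1 ->] /Jr; rewrite /square /= addrAC subrr add0r normrZ.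
    rewrite ger0_norm ?(le_trans _ s1) // leNgt => /negP; apply.
    by rewrite (lt_le_trans ur) // ler_peMl // ltW.
  - apply: (@star_connected _ _ _ u) => _ [s s1 ->] t /andP[t0 t1].
    exists (1 + t * (s - 1)); first by rewrite lerDl mulr_ge0 // subr_ge0.
    have -> : c + s *: (u - c) - u = (s - 1) *: (u - c).
      by rewrite scalerBl scale1r opprB [RHS]addrCA addrA.
    by rewrite scalerDl scale1r scalerA addrA (addrC c) subrK.
pose s := 1 + (`|M| + `|c| + 1) / `|u - c|.
have s1 : 1 <= s by rewrite lerDl divr_ge0 // !addr_ge0.
have := bM (`|M| + 1) _ (c + s *: (u - c)) (rayC _ (ex_intro2 _ _ s s1 erefl)).
have MM : M < `|M| + 1 by rewrite (le_lt_trans (ler_norm _)) // ltrDl.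
move=> /(_ MM) /=; apply/negP; rewrite -ltNge.
have := ler_normB (c + s *: (u - c)) c; rewrite addrAC subrr add0r normrZ.
rewrite (ger0_norm (le_trans ler01 s1)) /s mulrDl mul1r divfK ?gt_eqF //.
lra.
Qed.

(** Otherwise iterating the translation would carry a point out of the bounded set. *)
Lemma shift_sub_eq0 A v c (r : R) : A !=set0 -> A `<=` square c r ->
  shift_set v A `<=` A -> v = 0.
Proof.
move=> [a Aa] Ar sA; apply/eqP/negPn/negP => v0.
have An n : A (a + n%:R *: v).
  elim: n => [|n IH]; first by rewrite scale0r addr0.
  by apply: sA; rewrite shift_setE -natr1 scalerDl scale1r addrA addrK.
have vp : 0 < `|v| by rewrite normr_gt0.
pose n := Num.bound ((r + `|a - c| + 1) / `|v|).
have /Ar := An n; rewrite /square /=; apply/negP; rewrite -ltNge.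
have r0 : 0 <= r by apply: le_trans (Ar _ Aa).
have h : 0 <= (r + `|a - c| + 1) / `|v| by rewrite divr_ge0 // !addr_ge0.
have := archi_boundP h; rewrite -/n ltr_pdivrMr // => hn.
have := ler_normB (a + n%:R *: v - c) (a - c).
have -> : a + n%:R *: v - c - (a - c) = n%:R *: v.
  by rewrite opprB [a + _]addrC !addrA subrK addrK.
rewrite normrZ ger0_norm //; lra.
Qed.

End ShiftScale.

(** * Tiles, tilings and self-similarity *)

Section ShiftTiles.
Context {R : realType} {L : Type}.
Implicit Types (x y z v w : plane R) (A : set (plane R)) (s t p q : tile R L)
  (Q : set (tile R L)).

Lemma shift_tileD x y t : shift_tile x (shift_tile y t) = shift_tile (x + y) t.
Proof. by rewrite /shift_tile /= shift_setD. Qed.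

Lemma shift_tile0 t : shift_tile 0 t = t.
Proof. by case: t => A l; rewrite /shift_tile /= shift_set0. Qed.

Lemma shift_tileK x t : shift_tile (- x) (shift_tile x t) = t.
Proof. by rewrite shift_tileD addNr shift_tile0. Qed.

Lemma shift_tileKV x t : shift_tile x (shift_tile (- x) t) = t.
Proof. by rewrite shift_tileD addrN shift_tile0. Qed.

Lemma shift_patchE x Q t : shift_patch x Q t = Q (shift_tile (- x) t).
Proof.
apply/propext; split=> [[u Qu <-]|Qt]; first by rewrite shift_tileK.
by exists (shift_tile (- x) t) => //; rewrite shift_tileKV.
Qed.

Lemma shift_patchD x y Q : shift_patch x (shift_patch y Q) = shift_patch (x + y) Q.
Proof. by apply/seteqP; split=> t; rewrite !shift_patchE shift_tileD opprD addrC. Qed.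

Lemma shift_patch0 Q : shift_patch 0 Q = Q.
Proof. by apply/seteqP; split=> t; rewrite shift_patchE oppr0 shift_tile0. Qed.

Lemma disk_in_square A : homeomorphic (@closed_disk R) A ->
  exists r : R, 0 <= r /\ A `<=` square 0 r.
Proof.
case=> f [g /disk_compact /compact_bounded [M [_ bM]]]; exists (`|M| + 1); split.
  by rewrite addr_ge0.
move=> z Az; rewrite /square /= subr0; apply: bM Az.
by rewrite (le_lt_trans (ler_norm _)) // ltrDl.
Qed.

Lemma disk_nonempty A : homeomorphic (@closed_disk R) A -> A !=set0.
Proof.
by case=> f [g /disk_interior_nonempty[z /interior_subset ?]]; exists z.
Qed.

Lemma prototile_translates P p q x y : is_prototile_set P -> P p -> P q ->
  shift_tile x p = shift_tile y q -> p = q /\ x = y.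
Proof.
move=> [_ disks uniqP] Pp Pq e.
have e' : shift_tile (x - y) p = q.
  by rewrite addrC -shift_tileD e shift_tileK.
have epq : p = q by rewrite -e'; apply/esym/uniqP => //; rewrite e'.
split=> //; apply/eqP; rewrite -subr_eq0; apply/eqP.
have [_ dp] := disks _ Pp.
have [r [_ pr]] := disk_in_square dp.
apply: (shift_sub_eq0 (disk_nonempty dp) pr).
by rewrite -[X in X `<=` _]/(supp (shift_tile (x - y) p)) e' epq.
Qed.

Section Tiling.
Context (P T : set (tile R L)) (tilT : is_tiling P T).

Lemma tile_prototile t : T t -> exists p x, P p /\ t = shift_tile x p.
Proof. by case: tilT => _ _ [h _] _ _; exact: h. Qed.

Lemma tile_disk t : T t -> homeomorphic (@closed_disk R) (supp t).
Proof.
move=> /tile_prototile[p [x [Pp ->]]]; apply: shift_homeomorphic.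
by case: tilT => -[_ /(_ _ Pp)[]].
Qed.

Lemma tile_closed t : T t -> closed (supp t).
Proof. by move=> /tile_disk [f [g]]; exact: disk_closed. Qed.

Lemma tile_cover z : exists2 t, T t & supp t z.
Proof.
case: tilT => _ _ _ cov _; have : (\bigcup_(t in T) supp t) z by rewrite cov.
by case=> t; exists t.
Qed.

(** A point of [s] is a limit of interior points of [s], so an open set around it inside [t] would
    make the two interiors meet. *)
Lemma tile_interior_disjoint s t z : T s -> T t -> s <> t -> supp s z ->
  ~ interior (supp t) z.
Proof.
move=> Ts Tt st sz iz; have [f [g h]] := tile_disk Ts.
have [w [is_ it]] := disk_regular h sz (open_nbhs_nbhs (conj (@open_interior _ _) iz)).
case: tilT => _ _ _ _ /(_ _ _ Ts Tt st) dis.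
have : (interior (supp s) `&` interior (supp t)) w by split.
by rewrite dis.
Qed.

Lemma tile_bd s t z : T s -> T t -> s <> t -> supp s z -> supp t z -> bd (supp s) z.
Proof.
move=> Ts Tt st sz tz; rewrite bd_closed; last exact: tile_closed.
by split=> //; apply: tile_interior_disjoint Tt Ts _ tz => e; apply: st.
Qed.

Lemma tiling_diameter : exists D : R, 0 <= D /\
  forall t u v, T t -> supp t u -> supp t v -> `|u - v| <= D.
Proof.
have /choice[d dP] : forall p, exists r : R, P p -> 0 <= r /\ supp p `<=` square 0 r.
  move=> p; have [Pp|nPp] := pselect (P p); last by exists 0.
  have [r rP] : exists r : R, 0 <= r /\ supp p `<=` square 0 r.
    by apply: disk_in_square; case: tilT => -[_ /(_ _ Pp)[]].
  by exists r.
have /finite_seqP[s sE] : finite_set (d @` P).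
  by apply: finite_image; case: tilT => -[].
pose M := \big[Num.max/0]_(r <- s) r.
have dM p : P p -> d p <= M.
  move=> Pp; have : [set` s] (d p) by rewrite -sE; exists p.
  by move=> /= ps; apply: (le_bigmax_seq 0 (d p) xpredT id ps).
exists (2 * M); split; first by rewrite mulr_ge0 // bigmax_ge_id.
move=> _ u v /tile_prototile[p [x [Pp ->]]] /=; rewrite !shift_setE => pu pv.
have [_ pd] := dP _ Pp; have := pd _ pu; have := pd _ pv.
rewrite /square /= !subr0 => hv hu; have := dM _ Pp.
have -> : u - v = (u - x) - (v - x) by rewrite opprB addrA subrK.
have := ler_normB (u - x) (v - x); lra.
Qed.

End Tiling.
End ShiftTiles.

(** * Tiles inside a dilated tile, and the digits of the substitution *)

Section SelfSimilar.
Context {R : realType} {L : Type}.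
Context (P T : set (tile R L)) (lam : R).
Context (tilT : is_tiling P T) (selfT : self_similar T lam).

Lemma scale_setE (c : R) (A : set (plane R)) (z : plane R) :
  c != 0 -> scale_set c A z = A (c^-1 *: z).
Proof.
move=> c0; apply/propext; split=> [[w Aw <-]|Az].
  by rewrite scalerA mulVf // scale1r.
by exists (c^-1 *: z) => //; rewrite scalerA mulfV // scale1r.
Qed.

Lemma lam_gt0 : 0 < lam.
Proof. by case: selfT => h _ _; rewrite (lt_trans _ h). Qed.

Lemma lam_neq0 : lam != 0.
Proof. by rewrite gt_eqF // lam_gt0. Qed.

Let scK : cancel (fun z : plane R => lam *: z) (fun z => lam^-1 *: z).
Proof. by move=> z; rewrite scalerA mulVf ?scale1r // lam_neq0. Qed.

Let scVK : cancel (fun z : plane R => lam^-1 *: z) (fun z => lam *: z).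
Proof. by move=> z; rewrite scalerA mulfV ?scale1r // lam_neq0. Qed.

Lemma scale_interior A : interior (scale_set lam A) = scale_set lam (interior A).
Proof.
by apply: (@image_interior _ (fun z : plane R => lam *: z) (fun z => lam^-1 *: z));
  [exact: scaler_continuous | exact: scaler_continuous | exact: scK | exact: scVK].
Qed.

Lemma scale_bd A : bd (scale_set lam A) = scale_set lam (bd A).
Proof.
by apply: (@image_bd _ (fun z : plane R => lam *: z) (fun z => lam^-1 *: z));
  [exact: scaler_continuous | exact: scaler_continuous | exact: scK | exact: scVK].
Qed.

Lemma scale_closed A : closed A -> closed (scale_set lam A).
Proof.
move=> cA; rewrite /scale_set (image_preimage_can scK scVK).
by apply: closed_comp => // x _; exact: scaler_continuous.
Qed.

Lemma scale_shift (w : plane R) A :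
  scale_set lam (shift_set w A) = shift_set (lam *: w) (scale_set lam A).
Proof.
apply/seteqP; split=> z; rewrite shift_setE !scale_setE ?lam_neq0 // shift_setE;
  by rewrite scalerBr scK.
Qed.

(** The interior of [s] is connected and avoids the boundary of the dilated tile, which lies in the
    boundary of [T]; meeting the interior, it stays there, and taking closures gives the support. *)
Lemma scaled_tile_absorbs s t z : T s -> T t ->
  interior (scale_set lam (supp t)) z -> supp s z -> supp s `<=` scale_set lam (supp t).
Proof.
move=> Ts Tt iz sz; have [f [g h]] := tile_disk tilT Ts.
set A := scale_set lam (supp t) in iz *.
have cA : closed A by apply: scale_closed; exact: tile_closed tilT _ Tt.
have sub : interior (supp s) `<=` interior A.
  apply: connected_boundary; first exact: disk_interior_connected h.
    exact: (disk_regular h sz (open_nbhs_nbhs (conj (@open_interior _ _) iz))).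
  apply/seteqP; split=> // u [iu]; rewrite scale_bd => bu.
  have [t' Tt' bt'] : tbd T u.
    by case: selfT => _ h2 _; apply: h2; case: bu => v bv <-; exists v => //; exists t.
  have [e|ne] := pselect (t' = s); first by move: bt'; rewrite e => -[_].
  have ct' : supp t' u.
    by case: bt'; rewrite -(iffLR (closure_id _) (tile_closed tilT Tt')).
  exact: (tile_interior_disjoint tilT Tt' Ts ne ct').
rewrite [X in _ `<=` X](iffLR (closure_id _) cA).
apply: subset_trans (disk_regular h) _; apply: closureS.
by apply: subset_trans sub _; exact: interior_subset.
Qed.

(** Self-similarity only provides some translation [y]. The enclosed tiles cover the interior of the
    dilated tile, so [y - lam *: w] translates this bounded interior into itself and is zero. *)
Lemma enclosed_patch_shift t w : T t -> T (shift_tile w t) ->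
  enclosed_patch T (scale_set lam (supp (shift_tile w t))) =
  shift_patch (lam *: w) (enclosed_patch T (scale_set lam (supp t))).
Proof.
move=> Tt Twt; case: (selfT) => _ _ /(_ _ _ Tt Twt)[y ye]; rewrite ye.
suff -> : y = lam *: w by [].
apply/eqP; rewrite -subr_eq0; apply/eqP.
have [f [g h]] := tile_disk tilT Tt.
set A := scale_set lam (supp t) in ye *.
have A0 : interior A !=set0.
  have [z iz] := disk_interior_nonempty h.
  by exists (lam *: z); rewrite scale_interior; exists z.
have [r [_ Ar]] : exists r : R, 0 <= r /\ A `<=` square 0 r.
  have [r [r0 sr]] := disk_in_square (tile_disk tilT Tt).
  exists (lam * r); split; first by rewrite mulr_ge0 // ltW // lam_gt0.
  move=> _ [v /sr vr <-]; rewrite /square /= subr0 normrZ gtr0_norm ?lam_gt0 //.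
  by rewrite ler_pM2l ?lam_gt0 //; move: vr; rewrite /square /= subr0.
apply: (@shift_sub_eq0 _ (interior A) _ 0 r) => //.
  by apply: subset_trans Ar; exact: interior_subset.
have sub : shift_set (y - lam *: w) (interior A) `<=` A.
  move=> z; rewrite shift_setE => ia.
  have [s Ts sz] := tile_cover tilT (z - (y - lam *: w)).
  have Es : enclosed_patch T A s by split => //; exact: scaled_tile_absorbs ia sz.
  have : shift_patch y (enclosed_patch T A) (shift_tile y s) by exists s.
  rewrite -ye => -[_]; rewrite /= scale_shift => /(_ (z + lam *: w)).
  rewrite !shift_setE addrK; apply; move: sz; rewrite opprB addrA.
  by rewrite addrAC.
have := interiorS sub; rewrite shift_interior.
by rewrite (iffLR (interior_id _) (@open_interior _ A)).
Qed.

(** The digits are read off at one chosen occurrence of [p]; [enclosed_patch_shift] transports them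
    to every other. *)
Lemma digits_shift p q (d x : plane R) : P p -> T (shift_tile x p) ->
  digits T lam p q d ->
  T (shift_tile (d + lam *: x) q) /\
  supp (shift_tile (d + lam *: x) q) `<=` scale_set lam (supp (shift_tile x p)).
Proof.
move=> Pp Tx; rewrite /digits /omega /=; set o := occurrence T p.
have To : T (shift_tile o p) by apply: (@xgetPex _ 0 [set x | T (shift_tile x p)]); exists x.
have Tx' : T (shift_tile (x - o) (shift_tile o p)) by rewrite shift_tileD subrK.
have := enclosed_patch_shift To Tx'; rewrite shift_tileD subrK => xo.
rewrite shift_patchE shift_tileD opprK addrC => dq.
have : enclosed_patch T (scale_set lam (supp (shift_tile x p))) (shift_tile (d + lam *: x) q).
  rewrite xo shift_patchE shift_tileD.
  by rewrite scalerBr opprB [d + _]addrC addrA subrK addrC.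
by case.
Qed.

End SelfSimilar.

(** * The maps psi *)

Section GeometricGraphs.
Context {R : realType}.
Implicit Types (B C A : set (plane R)).

Lemma realization_vertex n (e : rel 'I_n) i :
  comb_graph e -> @realization R n e (delta_mx 0 i).
Proof.
move=> [_ _ _ /(_ i)[j ij]]; exists i, j; split => //; exists 0; first by rewrite lexx ler01.
by rewrite subr0 scale1r scale0r addr0.
Qed.

Lemma geo_vertex_sub B : geo_vertex B `<=` B.
Proof.
move=> _ [n [e [iota [i [[ce _ ->] _ ->]]]]].
by exists (delta_mx 0 i) => //; exact: realization_vertex.
Qed.

Lemma geo_graph_nonempty B : geo_graph B -> B !=set0.
Proof.
move=> [n [e [iota [ce _ ->]]]]; have [n0 _ _ _] := ce.
by exists (iota (delta_mx 0 (Ordinal n0))); exists (delta_mx 0 (Ordinal n0)) => //;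
  exact: realization_vertex.
Qed.

Lemma geo_graph_arc B z : geo_graph B -> B z -> exists2 A, geo_arc B A & A z.
Proof.
move=> [n [e [iota pr]]]; have [_ _ BE] := pr; rewrite {1}BE => -[u [i [j [ij su]]] <-].
exists (iota @` @simplex R n i j); last by exists u.
by exists n, e, iota, i, j.
Qed.

Lemma geo_equiv_maps B C h z : geo_equiv B C h -> B z -> C (h z).
Proof.
move=> [n [e [i1 [i2 [[_ _ ->] [_ _ ->] hE]]]]] [u ru <-].
by rewrite hE //; exists u.
Qed.

End GeometricGraphs.

(** * Iterates of [psi] for a recurrent pair *)

Section Recurrent.
Context {R : realType} {L : Type} {P T : set (tile R L)} {lam : R}.
Context {G S : tile R L -> set (plane R)} {psit : tile R L -> plane R -> plane R}.
Context {psi : plane R -> plane R}.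
Context (tilT : is_tiling P T) (selfT : self_similar T lam).
Context (GS : recurrent_pair P T lam G S psit).
Context (SRG : forall p, P p -> S p `<=` Rop P T lam G p).
Context (G_arcs : arcs_on_empty_curves P T G).
Context (tilG : exists P0, is_tiling P0 (TG P T G)).
Context (psi_def : is_psi P T (TG P T G) psit psi).

(** If [z] comes from the graph of another tile, it is a common boundary point, hence a boundary
    vertex of that graph, and [T]-consistency makes its counterpart on [p] a vertex of [G p]. *)
Lemma Gamma_tile p x z : Gamma P T G z -> P p -> T (shift_tile x p) ->
  supp (shift_tile x p) z -> G p (z - x).
Proof.
move=> [q [y [Pq Tq]]]; rewrite shift_setE => Gq Pp Tp pz.
have [protP _ _ _ _] := tilT.
have [e|ne] := pselect (shift_tile y q = shift_tile x p).
  by have [<- <-] := prototile_translates protP Pq Pp e.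
have [[[gG Gbd [_ GT]] _] _ _ _] := GS.
have qz : supp (shift_tile y q) z.
  by rewrite /= shift_setE; have [_] := gG _ Pq; apply.
have bq : bd (supp q) (z - y).
  by have := tile_bd tilT Tq Tp ne qz pz; rewrite /= shift_bd shift_setE.
have bp : bd (supp p) (z - x).
  have ne' : shift_tile x p <> shift_tile y q by move=> /esym.
  by have := tile_bd tilT Tp Tq ne' pz qz; rewrite /= shift_bd shift_setE.
have Cq : [set pv | P pv.1 /\ boundary_vertex pv.1 (G pv.1) pv.2] (q, z - y).
  by split => //; apply: Gbd.
have /(GT _ _ Cq)[_ [/geo_vertex_sub //]] : simT P T (q, z - y) (p, z - x).
by apply: rst_step; split => //; exists y, x; rewrite !subrK.
Qed.

Lemma TG_bd J : empty_jordan_curve (Gamma P T G) J -> bd (enclosed J) = J.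
Proof.
move=> eJ; have [P0 tP0] := tilG; case: (eJ) => jJ _ _; apply: bd_enclosed => //.
have TJ : TG P T G (Tile (enclosed J) (patch_class J (meeting T J))) by exists J.
exact: tile_disk tP0 _ TJ.
Qed.

Lemma tbd_TG : tbd (TG P T G) = Gamma P T G.
Proof.
apply/seteqP; split=> [z [_ [J eJ ->]]|z [p [x [Pp Tp Gz]]]].
  by rewrite /= TG_bd //; case: eJ => _ + _; apply.
have [[[gG _ _] _] _ _ _] := GS; have [ggp _] := gG _ Pp.
move: Gz; rewrite shift_setE => /(geo_graph_arc ggp)[A aA Az].
have [J eJ AJ] := G_arcs Pp Tp aA.
exists (Tile (enclosed J) (patch_class J (meeting T J))); first by exists J.
by rewrite /= TG_bd //; apply: AJ; rewrite shift_setE.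
Qed.

(** The step behind the inductions below. [q] and the digit [e - lam *: x] are chosen from [p] and
    [z - x] alone, which is why translating the tile by [w] moves the receiving tile by
    [lam *: w]. *)
Lemma lampsi_tile p x z : Gamma P T G z -> P p -> T (shift_tile x p) ->
    supp (shift_tile x p) z ->
  exists q e, [/\ P q, T (shift_tile e q),
    supp (shift_tile e q) `<=` scale_set lam (supp (shift_tile x p)),
    shift_set e (G q) (lampsi lam psi z)
    & forall w, T (shift_tile (x + w) p) -> T (shift_tile (e + lam *: w) q)].
Proof.
move=> Gz Pp Tp pz; have Gp := Gamma_tile Gz Pp Tp pz.
have [_ _ /(_ _ Pp) eqv _] := GS.
have [q [d [Pq dq]]] := SRG Pp (geo_equiv_maps eqv Gp).
have l0 := lam_neq0 selfT.
rewrite scale_setE ?invr_eq0 // invrK => Gq.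
have [Te sub] := digits_shift tilT selfT Pp Tp dq.
exists q, (d + lam *: x); split => //.
  rewrite -[d + _]addrC -shift_setD shift_setE /lampsi.
  rewrite (psi_def _ Pp Tp pz); last by rewrite tbd_TG.
  by rewrite scalerDr addrK.
move=> w Tw; have [+ _] := digits_shift tilT selfT Pp Tw dq.
by rewrite scalerDr addrA.
Qed.

Lemma tile_at z : exists p x, [/\ P p, T (shift_tile x p) & supp (shift_tile x p) z].
Proof.
have [t Tt tz] := tile_cover tilT z; have [p [x [Pp e]]] := tile_prototile tilT Tt.
by exists p, x; rewrite -e.
Qed.

Lemma lampsi_Gamma z : Gamma P T G z -> Gamma P T G (lampsi lam psi z).
Proof.
move=> Gz; have [p [x [Pp Tp pz]]] := tile_at z.
by have [q [e [Pq Te _ Gq _]]] := lampsi_tile Gz Pp Tp pz; exists q, e.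
Qed.

Lemma iter_lampsi_Gamma n z : Gamma P T G z -> Gamma P T G (iter n (lampsi lam psi) z).
Proof. by move=> Gz; elim: n => // n IH; exact: lampsi_Gamma. Qed.

Lemma psin0 z : psin lam psi 0 z = z.
Proof. by rewrite /psin expr0 invr1 scale1r. Qed.

Lemma psin1 z : psin lam psi 1 z = psi z.
Proof. by rewrite /psin expr1 /= /lampsi scalerA mulVf ?scale1r // (lam_neq0 selfT). Qed.

Lemma psinSr n z : psin lam psi n.+1 z = lam^-1 *: psin lam psi n (lampsi lam psi z).
Proof. by rewrite /psin iterSr scalerA exprS invfM. Qed.

Lemma psin_add m n z :
  psin lam psi m (iter n (lampsi lam psi) z) = lam ^+ n *: psin lam psi (m + n) z.
Proof.
rewrite /psin iterD scalerA exprD invfM mulrCA mulrV ?mulr1 //.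
by rewrite unitfE expf_neq0 // (lam_neq0 selfT).
Qed.

Lemma G_sub_supp q e z : P q -> shift_set e (G q) z -> supp (shift_tile e q) z.
Proof.
have [[[gG _ _] _] _ _ _] := GS; move=> Pq; rewrite /= !shift_setE.
by have [_] := gG _ Pq; apply.
Qed.

(** By [psinSr] and induction, [lam] times the next iterate stays in the receiving tile, which lies
    inside [lam t]. *)
Lemma psin_tile n z t : Gamma P T G z -> T t -> supp t z -> supp t (psin lam psi n z).
Proof.
elim: n z t => [|n IH] z t Gz Tt tz; first by rewrite psin0.
have [p [x [Pp tE]]] := tile_prototile tilT Tt; rewrite tE in Tt tz *.
have [q [e [Pq Te sub Gq _]]] := lampsi_tile Gz Pp Tt tz.
have := sub _ (IH _ _ (lampsi_Gamma Gz) Te (G_sub_supp Pq Gq)).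
by rewrite scale_setE ?(lam_neq0 selfT) // psinSr.
Qed.

Lemma Gamma_shift z t w : Gamma P T G z -> T t -> supp t z -> T (shift_tile w t) ->
  Gamma P T G (z + w).
Proof.
move=> Gz Tt tz Tw; have [p [x [Pp tE]]] := tile_prototile tilT Tt.
rewrite tE in Tt tz Tw; have Gp := Gamma_tile Gz Pp Tt tz.
exists p, (w + x); split => //; first by rewrite -shift_tileD.
by rewrite shift_setE opprD addrA addrK.
Qed.

(** The same recursion: a shift by [w] becomes a shift by [lam *: w] of the receiving tile, and the
    factor [lam^-1] brings it back to [w]. *)
Lemma psin_shift n z t w : Gamma P T G z -> T t -> supp t z -> T (shift_tile w t) ->
  psin lam psi n (z + w) = psin lam psi n z + w.
Proof.
elim: n z t w => [|n IH] z t w Gz Tt tz Tw; first by rewrite !psin0.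
have Gzw := Gamma_shift Gz Tt tz Tw.
have [p [x [Pp tE]]] := tile_prototile tilT Tt; rewrite tE in Tt tz Tw.
have Txw : T (shift_tile (x + w) p) by rewrite addrC -shift_tileD.
have [q [e [Pq Te sub Gq Tew]]] := lampsi_tile Gz Pp Tt tz.
rewrite !psinSr.
have -> : lampsi lam psi (z + w) = lampsi lam psi z + lam *: w.
  rewrite /lampsi -scalerDr; congr (_ *: _).
  rewrite (psi_def _ Pp Tt tz) ?tbd_TG // (psi_def _ Pp Txw) ?tbd_TG //.
    by rewrite opprD addrACA subrr addr0 addrA.
  by rewrite /= shift_setE opprD addrACA subrr addr0; move: tz; rewrite /= shift_setE.
rewrite (IH _ (shift_tile e q)) //.
- by rewrite scalerDr (scalerA _ _ w) mulVf ?scale1r // (lam_neq0 selfT).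
- exact: lampsi_Gamma.
- exact: G_sub_supp.
- by rewrite shift_tileD addrC; apply: Tew.
Qed.

Lemma psin_cvg z : Gamma P T G z -> cvgn (psin lam psi ^~ z).
Proof.
move=> Gz; have [D [D0 Dd]] := tiling_diameter tilT.
have l0 := lam_gt0 selfT; have l1 : 1 < lam by case: selfT.
pose d n := psin lam psi n.+1 z - psin lam psi n z.
(* The increment is [lam^-n] times the displacement of [psi] at a point of the graph, at most the
   tile diameter [D] since [psi] keeps points in their tiles. *)
have dn n : `|d n| <= geometric D lam^-1 n.
  have [t Tt tw] := tile_cover tilT (iter n (lampsi lam psi) z).
  have Gw := iter_lampsi_Gamma n Gz.
  have pw := psin_tile 1 Gw Tt tw; rewrite psin1 in pw.
  have -> : d n = lam^-1 ^+ n *: (psi (iter n (lampsi lam psi) z) - iter n (lampsi lam psi) z).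
    rewrite /d /psin scalerBr exprVn; congr (_ - _).
    by rewrite iterS /lampsi scalerA exprSr invfM mulrVK // unitfE gt_eqF.
  have i0 : 0 <= lam^-1 ^+ n by rewrite exprn_ge0 // invr_ge0 ltW.
  rewrite normrZ (ger0_norm i0) /geometric /= mulrC.
  by apply: ler_wpM2r => //; apply: Dd tw.
have cd : cvgn (series d).
  suff nd : cvgn [normed series d].
    apply/cauchy_cvgP/cauchy_seriesP => e e0.
    move/cauchy_cvgP/cauchy_seriesP/(_ e e0): nd; apply: filterS => n /=.
    rewrite ger0_norm ?sumr_ge0 //; apply: le_lt_trans; exact: ler_norm_sum.
  apply: series_le_cvg dn _.
  - by move=> n; exact: normr_ge0.
  - by move=> n; rewrite /geometric /= mulr_ge0 // exprn_ge0 // invr_ge0 ltW.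
  - apply: is_cvg_geometric_series.
    have i0 : 0 <= lam^-1 by rewrite invr_ge0 ltW.
    by rewrite ger0_norm // invf_lt1.
have -> : psin lam psi ^~ z = series d + cst z.
  apply/funext => n; rewrite /series /= fctE /= /d telescope_sumr // psin0 subrK //.
by apply: is_cvgD => //; exact: is_cvg_cst.
Qed.

End Recurrent.

(** * Local derivability *)

Section LocalDerivability.
Context {R : realType}.

Lemma eball_norm (x y : plane R) (r : R) : 0 <= r -> eball x r y -> `|x - y| <= r.
Proof.
move=> r0; rewrite /eball /= sqnormE !mxE distrC => h.
have sq (a : R) : a ^+ 2 <= r ^+ 2 -> `|a| <= r by rewrite -real_normK ?num_real // ler_sqr.
rewrite dist2_le; have := sqr_ge0 (y 0 0 - x 0 0); have := sqr_ge0 (y 0 1 - x 0 1).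
by move=> h0 h1; apply/andP; split; apply: sq; lra.
Qed.

(** The factor 2 exceeds the square root of 2 between the sup norm and the Euclidean one; the
    summand 1 makes the inequality strict even for [r = 0]. *)
Lemma norm_eball (x y : plane R) (r : R) : `|x - y| <= r -> eball x (2 * r + 1) y.
Proof.
move=> xy; have r0 : 0 <= r by exact: le_trans xy.
move: xy; rewrite distrC /eball /= sqnormE !mxE dist2_le => /andP[h0 h1].
have sq (a : R) : `|a| <= r -> a ^+ 2 <= r ^+ 2 by rewrite -[a ^+ 2]real_normK ?num_real // ler_sqr.
have := sq _ h0; have := sq _ h1; nra.
Qed.

(** A tilewise form of the patch equality in local derivability, in the sup norm; it restricts
    directly to smaller balls around other centres. *)
Definition locally_match (L : Type) (T : set (tile R L)) (x y : plane R) (r : R) :=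
  forall t u, supp t u -> `|x - u| <= r -> T t <-> T (shift_tile (y - x) t).

Lemma shift_tile_back (L : Type) (x y : plane R) (t : tile R L) :
  shift_tile (y - x) (shift_tile (x - y) t) = t.
Proof. by rewrite shift_tileD addrA subrK subrr shift_tile0. Qed.

Lemma dist_shift (x y u : plane R) : y - (u + (y - x)) = x - u.
Proof. by rewrite opprD opprB addrCA [y + _]addrC subrK addrC. Qed.

Lemma eball_shift (x y w : plane R) (r : R) : eball y r (w + (y - x)) = eball x r w.
Proof. by rewrite /eball /= -[X in sqnorm X]opprB dist_shift opprB. Qed.

Lemma locally_match_sym (L : Type) (T : set (tile R L)) x y r :
  locally_match T x y r -> locally_match T y x r.
Proof.
move=> m t u tu yu; have := m (shift_tile (x - y) t) (u + (x - y)).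
rewrite shift_tile_back dist_shift => h.
by apply: iff_sym; apply: h; rewrite //= shift_setE addrK.
Qed.

Lemma locally_match_meeting (L : Type) (T : set (tile R L)) x y r : 0 <= r ->
  locally_match T x y r ->
  meeting T (eball x r) = shift_patch (x - y) (meeting T (eball y r)).
Proof.
move=> r0 m; apply/seteqP; split=> s.
  move=> [Ts [w [sw xw]]]; rewrite shift_patchE opprB; split.
    by apply/(m s w) => //; exact: eball_norm.
  exists (w + (y - x)); split; first by rewrite /= shift_setE addrK.
  by rewrite eball_shift.
rewrite shift_patchE opprB => -[Ts [w [/= sw yw]]].
rewrite shift_setE in sw; set w' := w - (y - x) in sw.
have xw : eball x r w'.
  by move: yw; rewrite -[w](subrK (y - x)) eball_shift.
by split; [apply/(m s w') => //; exact: eball_norm | exists w'].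
Qed.

Lemma meeting_locally_match (L : Type) (T : set (tile R L)) x y r :
  meeting T (eball x (2 * r + 1)) = shift_patch (x - y) (meeting T (eball y (2 * r + 1))) ->
  locally_match T x y r.
Proof.
move=> e t u tu xu; split=> [Tt|Tt].
  have : meeting T (eball x (2 * r + 1)) t by split => //; exists u; split => //; exact: norm_eball.
  by rewrite e shift_patchE opprB => -[].
have : meeting T (eball x (2 * r + 1)) t; last by case.
rewrite e shift_patchE opprB; split => //; exists (u + (y - x)); split.
  by rewrite /= shift_setE addrK.
by apply: norm_eball; rewrite dist_shift.
Qed.

(** Matching is symmetric in [x] and [y], so carrying tiles in one direction yields both
    inclusions. *)
Lemma locally_derivable_intro (L L' : Type)
    (T : set (tile R L)) (T' : set (tile R L')) (r : R) :
    0 <= r ->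
    (forall x y, locally_match T x y r ->
      forall t, T' t -> supp t x -> T' (shift_tile (y - x) t)) ->
  locally_derivable T T'.
Proof.
move=> r0 h; exists (2 * r + 1); first by rewrite ltr_wpDl // mulr_ge0.
move=> x y e; have m := meeting_locally_match e.
apply/seteqP; split=> t.
  move=> [Tt [u [tx /= ux]]]; subst u; rewrite shift_patchE opprB; split; first exact: h m _ Tt tx.
  by exists y; split => //; rewrite /= shift_setE opprB addrC subrK.
rewrite shift_patchE opprB => -[Tt [u [ty /= uy]]]; subst u.
have := h _ _ (locally_match_sym m) _ Tt ty.
rewrite shift_tile_back => Tt'; split => //.
by exists x; split => //; move: ty; rewrite /= shift_setE opprB addrC subrK.
Qed.

Lemma locally_derivable_trans (L1 L2 L3 : Type) (T1 : set (tile R L1))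
    (T2 : set (tile R L2)) (T3 : set (tile R L3)) :
  locally_derivable T1 T2 -> locally_derivable T2 T3 -> locally_derivable T1 T3.
Proof.
move=> [r1 r10 h12] [r2 r20 h23].
(* Tiles of [T2] within [r2] of the centre are determined by [T1] within a further [r1]. *)
exists (2 * (r1 + r2) + 1); first by rewrite ltr_wpDl // mulr_ge0 // addr_ge0 // ltW.
move=> x y e; have m := meeting_locally_match e; apply: h23.
apply: locally_match_meeting; first exact: ltW.
have half x' y' : locally_match T1 x' y' (r1 + r2) ->
    forall t u, supp t u -> `|x' - u| <= r2 -> T2 t -> T2 (shift_tile (y' - x') t).
  move=> {e}{}m t u tu xu Tt; pose v := u + (y' - x').
  have vu : v - u = y' - x' by rewrite /v addrAC subrr add0r.
  have /h12 e : meeting T1 (eball u r1) = shift_patch (u - v) (meeting T1 (eball v r1)).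
    apply: locally_match_meeting (ltW r10) _ => s w sw uw; rewrite vu; apply: m sw _.
    by rewrite (addrC r1) (le_trans (ler_distD u _ _)) // lerD.
  have : meeting T2 [set u] t by split => //; exists u.
  by rewrite e shift_patchE opprB vu => -[].
move=> t u tu xu; split; first exact: half m _ _ tu xu.
have := half _ _ (locally_match_sym m) (shift_tile (y - x) t) (u + (y - x)).
rewrite shift_tile_back dist_shift; apply => //.
by rewrite /= shift_setE addrK.
Qed.

Lemma MLD_sym (L1 L2 : Type) (T1 : set (tile R L1)) (T2 : set (tile R L2)) :
  MLD T1 T2 -> MLD T2 T1.
Proof. by case. Qed.

Lemma MLD_trans (L1 L2 L3 : Type) (T1 : set (tile R L1))
    (T2 : set (tile R L2)) (T3 : set (tile R L3)) :
  MLD T1 T2 -> MLD T2 T3 -> MLD T1 T3.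
Proof.
by move=> [h1 h2] [h3 h4]; split;
  [exact: locally_derivable_trans h1 h3 | exact: locally_derivable_trans h4 h2].
Qed.

End LocalDerivability.

(** * The limit map, and deformations of [T_G] that are MLD with [T] *)

Section Deformations.
Context {R : realType} {L : Type} {P T : set (tile R L)} {lam : R}.
Context {G S : tile R L -> set (plane R)} {psit : tile R L -> plane R -> plane R}.
Context {psi : plane R -> plane R}.
Context (tilT : is_tiling P T) (selfT : self_similar T lam).
Context (GS : recurrent_pair P T lam G S psit).
Context (SRG : forall p, P p -> S p `<=` Rop P T lam G p).
Context (G_arcs : arcs_on_empty_curves P T G).
Context (tilG : exists P0, is_tiling P0 (TG P T G)).
Context (psi_def : is_psi P T (TG P T G) psit psi).

Lemma psi_inf_cvg z : Gamma P T G z -> psin lam psi n z @[n --> \oo] --> psi_inf lam psi z.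
Proof. exact: psin_cvg tilT selfT GS SRG G_arcs tilG psi_def _. Qed.

Lemma psi_inf_unique z l : psin lam psi n z @[n --> \oo] --> l -> psi_inf lam psi z = l.
Proof. by move=> h; rewrite /psi_inf; apply: cvg_lim h; exact: norm_hausdorff. Qed.

Lemma psi_inf_tile z t : Gamma P T G z -> T t -> supp t z -> supp t (psi_inf lam psi z).
Proof.
move=> Gz Tt tz; apply: (closed_cvg _ (tile_closed tilT Tt)) _ (psi_inf_cvg Gz).
by near=> n; exact: psin_tile tilT selfT GS SRG G_arcs tilG psi_def n _ _ Gz Tt tz.
Unshelve. all: by end_near. Qed.

Lemma psi_inf_shift z t w : Gamma P T G z -> T t -> supp t z -> T (shift_tile w t) ->
  psi_inf lam psi (z + w) = psi_inf lam psi z + w.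
Proof.
move=> Gz Tt tz Tw; apply: psi_inf_unique.
have -> : psin lam psi ^~ (z + w) = fun n => psin lam psi n z + w.
  by apply/funext => n; exact: psin_shift tilT selfT GS SRG G_arcs tilG psi_def n _ _ _ Gz Tt tz Tw.
by apply: cvgD; [exact: psi_inf_cvg | exact: cvg_cst].
Qed.

Lemma psi_inf_iter z n : Gamma P T G z ->
  psi_inf lam psi (iter n (lampsi lam psi) z) = lam ^+ n *: psi_inf lam psi z.
Proof.
move=> Gz; apply: psi_inf_unique.
have -> : psin lam psi ^~ (iter n (lampsi lam psi) z) =
    fun m => lam ^+ n *: psin lam psi (m + n)%N z.
  by apply/funext => m; exact: psin_add selfT _ _ _.
have := psi_inf_cvg Gz; rewrite -(cvg_shiftn n) => h.
exact: cvgZl_tmp h.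
Qed.

Lemma patch_class_shift w (J : set (plane R)) (Q : set (tile R L)) :
  patch_class (shift_set w J) (shift_patch w Q) = patch_class J Q.
Proof.
apply/seteqP; split=> _ [z ->].
  by exists (z + w); rewrite shift_setD shift_patchD.
by exists (z - w); rewrite shift_setD shift_patchD subrK.
Qed.

Lemma patch_class_eq (J J' : set (plane R)) (Q Q' : set (tile R L)) :
  patch_class J' Q' = patch_class J Q ->
  exists z, J' = shift_set z J /\ Q' = shift_patch z Q.
Proof.
move=> e; have : patch_class J' Q' (J', Q').
  by exists 0; rewrite shift_set0 shift_patch0.
by rewrite e => -[z [-> ->]]; exists z.
Qed.

(** Makes [T^(0)] an instance of the deformations treated below. *)
Lemma deform_id : deform idfun (TG P T G) = TG P T G.
Proof.
apply/seteqP; split=> [_ [_ [J eJ ->] <-]|_ [J eJ ->]] /=.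
  by rewrite image_id (TG_bd tilG) //; exists J.
exists (Tile (enclosed J) (patch_class J (meeting T J))); first by exists J.
by rewrite /= image_id (TG_bd tilG).
Qed.

Section Deform.
Context (f : plane R -> plane R).
Context (f_tile : forall z t, Gamma P T G z -> T t -> supp t z -> supp t (f z)).
Context (f_shift : forall z t w, Gamma P T G z -> T t -> supp t z ->
  T (shift_tile w t) -> f (z + w) = f z + w).

Lemma image_shift w (J : set (plane R)) : J `<=` Gamma P T G ->
  (forall z t, J z -> T t -> supp t z -> T (shift_tile w t)) ->
  f @` shift_set w J = shift_set w (f @` J).
Proof.
move=> JG Jw; have fw z : J z -> f (z + w) = f z + w.
  move=> Jz; have [t Tt tz] := tile_cover tilT z.
  exact: f_shift (JG _ Jz) Tt tz (Jw _ _ Jz Tt tz).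
apply/seteqP; split=> [_ [_ [z Jz <-] <-]|_ [_ [z Jz <-] <-]].
  by rewrite fw // shift_setE addrK; exists z.
by exists (z + w); [exists z | exact: fw].
Qed.

Lemma Gamma_match x y r z : locally_match T x y r -> `|x - z| <= r ->
  Gamma P T G (z + (y - x)) <-> Gamma P T G z.
Proof.
move=> m xz; split=> -[p [a [Pp Ta Ga]]].
  have pz := G_sub_supp GS Pp Ga.
  have pz' : supp (shift_tile (a - (y - x)) p) z.
    by move: pz; rewrite /= !shift_setE opprB -addrA.
  exists p, (a - (y - x)); split => //.
    by apply/(m _ _ pz' xz); rewrite shift_tileD addrC subrK.
  by move: Ga; rewrite !shift_setE opprB -addrA.
have pz := G_sub_supp GS Pp Ga.
exists p, (a + (y - x)); split => //.
  by have /(m _ _ pz xz) := Ta; rewrite shift_tileD addrC.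
by move: Ga; rewrite !shift_setE opprD addrACA subrr addr0.
Qed.

(** One radius for all tiles: [E] bounds the diameters in [T_G], and [f] moves points by at most the
    diameter [D] of the tiles of [T]. *)
Lemma image_square : exists r : R, 0 <= r /\ forall J j, empty_jordan_curve (Gamma P T G) J ->
  J j -> enclosed J `<=` square j r /\ enclosed (f @` J) `<=` square j r.
Proof.
have [D [D0 Dd]] := tiling_diameter tilT.
have [P0 tP0] := tilG; have [E [E0 Ed]] := tiling_diameter tP0.
exists (D + E); split=> [|J j eJ Jj]; first exact: addr_ge0.
have near z : enclosed J z -> `|z - j| <= E.
  move=> Jz; have TJ : TG P T G (Tile (enclosed J) (patch_class J (meeting T J))) by exists J.
  by apply: Ed TJ _ _ => //; left.
split; first by move=> z /near zj; rewrite /square /= (le_trans zj) // lerDr.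
apply: enclosed_square; first exact: addr_ge0.
move=> _ [z Jz <-]; have [t Tt tz] := tile_cover tilT z.
have Gz : Gamma P T G z by case: eJ => _ + _; apply.
have fz := f_tile Gz Tt tz.
rewrite /square /= (le_trans (ler_distD z _ _)) // lerD //; first exact: Dd Tt fz tz.
by apply: near; left.
Qed.

(** The curve [J], its interior and the tiles meeting it are all seen within [r + r] of [x]. So the
    translate of [J] is again an empty curve with the translated patch, hence the same label, and
    [f] commutes with the translation on it. *)
Lemma deform_derivable : locally_derivable T (deform f (TG P T G)).
Proof.
have [r [r0 rP]] := image_square.
apply: (@locally_derivable_intro _ _ _ _ _ (r + r)); first exact: addr_ge0.
move=> x y m _ [_ [J eJ ->] <-] /=; rewrite (TG_bd tilG) // => xJ.
have [jJ JG Jin] := eJ; have [j0 Jj0] := jordan_curve_nonempty jJ.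
have [Jr fJr] := rP _ _ eJ Jj0.
have near z : enclosed J z -> `|x - z| <= r + r.
  move=> /Jr zj; rewrite (le_trans (ler_distD j0 _ _)) // lerD //; first exact: fJr.
  by rewrite distrC.
set w := y - x.
have Tw s u : J u -> supp s u -> T s <-> T (shift_tile w s).
  by move=> Ju su; apply: m su _; apply: near; left.
have eJ' : empty_jordan_curve (Gamma P T G) (shift_set w J).
  split; first exact: shift_homeomorphic.
    move=> _ [z Jz <-]; apply/(Gamma_match m); last exact: JG.
    by apply: near; left.
  apply/seteqP; split=> // u []; rewrite shift_inside => -[z iz zu] Gu.
  have : (inside J `&` Gamma P T G) z.
    split => //; apply/(Gamma_match m (near _ (or_intror iz))).
    by rewrite -/w; move: Gu; rewrite -zu.
  by rewrite Jin.
have mJ : meeting T (shift_set w J) = shift_patch w (meeting T J).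
  apply/seteqP; split=> s.
    move=> [Ts [u [su]]]; rewrite shift_setE => Ju; rewrite shift_patchE.
    have su' : supp (shift_tile (- w) s) (u - w) by rewrite /= shift_setE opprK subrK.
    by split; [apply/(Tw _ _ Ju su'); rewrite shift_tileKV | exists (u - w)].
  rewrite shift_patchE => -[Ts [u [su Ju]]]; split.
    by have /(Tw _ _ Ju su) := Ts; rewrite shift_tileKV.
  by exists (u + w); move: su; rewrite /= !shift_setE opprK addrK.
exists (Tile (enclosed (shift_set w J))
  (patch_class (shift_set w J) (meeting T (shift_set w J)))).
  by exists (shift_set w J).
rewrite /= (TG_bd tilG) // mJ patch_class_shift image_shift //.
  by rewrite shift_enclosed.
by move=> z t Jz Tt tz; apply/(Tw _ _ Jz tz).
Qed.

(** A tile [t0] of [T] is recovered from a deformed tile [tau] whose original curve [J] meets [t0].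
    The label of the tile matched with [tau] yields a translation [z] carrying the patch of [J] into
    [T]. *)
Lemma derivable_deform : locally_derivable (deform f (TG P T G)) T.
Proof.
have [D [D0 Dd]] := tiling_diameter tilT; have [r [r0 rP]] := image_square.
apply: (@locally_derivable_intro _ _ _ _ _ D) => // x y m t0 Tt0 tx.
have [p [a [Pp tE]]] := tile_prototile tilT Tt0.
have [[[gG _ _] _] _ _ _] := GS; have [ggp Gp] := gG _ Pp.
have [g Gg] := geo_graph_nonempty ggp.
have [A aA Ag] := geo_graph_arc ggp Gg.
have [J eJ AJ] := G_arcs Pp (eq_ind _ T Tt0 _ tE) aA.
have Jj : J (g + a) by apply: AJ; exists g.
have tj : supp t0 (g + a) by rewrite tE; exists g => //; exact: Gp.
have [jJ JG _] := eJ.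
have tfj := f_tile (JG _ Jj) Tt0 tj.
have [_ fJr] := rP _ _ eJ Jj.
pose tau := Tile (enclosed (f @` J)) (patch_class J (meeting T J)).
have Ttau : deform f (TG P T G) tau.
  exists (Tile (enclosed J) (patch_class J (meeting T J))); first by exists J.
  by rewrite /= (TG_bd tilG).
have tauj : supp tau (f (g + a)) by left; exists (g + a).
have /(m _ _ tauj (Dd _ _ _ Tt0 tx tfj)) := Ttau.
set w := y - x => -[_ [J' eJ' ->]]; rewrite /= (TG_bd tilG) // => -[eE eC].
have [z [zJ zQ]] := patch_class_eq eC.
have Tz s u : J u -> T s -> supp s u -> T (shift_tile z s).
  move=> Ju Ts su; have : shift_patch z (meeting T J) (shift_tile z s).
    by exists s => //; split => //; exists u.
  by rewrite -zQ => -[].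
(* The matched support is the [w]-translate of that of [tau] by assumption and its [z]-translate by
   equivariance of [f]; a bounded non-empty set has no non-zero period. *)
have eE' : shift_set z (enclosed (f @` J)) = shift_set w (enclosed (f @` J)).
  by rewrite -eE zJ image_shift // ?shift_enclosed // => u s; exact: Tz.
suff <- : z = w by exact: Tz Jj Tt0 tj.
apply/eqP; rewrite -subr_eq0; apply/eqP; apply: (shift_sub_eq0 _ fJr).
  by exists (f (g + a)); left; exists (g + a).
by rewrite addrC -shift_setD eE' shift_setD addNr shift_set0.
Qed.

Lemma deform_MLD : MLD T (deform f (TG P T G)).
Proof. by split; [exact: deform_derivable | exact: derivable_deform]. Qed.

End Deform.
End Deformations.

Theorem lemma5p6 (R : realType) (L : Type) (P T : set (tile R L)) (lam : R)
    (G S : tile R L -> set (plane R))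
    (psit : tile R L -> plane R -> plane R) (psi : plane R -> plane R)
    (T_tiling : is_tiling P T)
    (T_FLC : FLC T)
    (T_self_similar : self_similar T lam)
    (GS_recurrent : recurrent_pair P T lam G S psit)
    (S_sub_RG : forall p, P p -> S p `<=` Rop P T lam G p)
    (G_arcs : arcs_on_empty_curves P T G)
    (TG_tiling : exists P0, is_tiling P0 (TG P T G))
    (psi_def : is_psi P T (TG P T G) psit psi)
    (psi_inf_inj : set_inj (tbd (TG P T G)) (psi_inf lam psi)) :
  [/\ (forall z, tbd (TG P T G) z -> psin lam psi 1 z = psi z),
      (forall z t, tbd (TG P T G) z -> T t -> supp t z ->
         forall n : nat, supp t (psin lam psi n z)),
      (forall n : nat,
         let T0 := TG P T G in
         let Tn := deform (psin lam psi n) T0 in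
         let Tinf := deform (psi_inf lam psi) T0 in
         [/\ MLD T T0, MLD T Tn & MLD T Tinf] /\
         [/\ MLD T0 Tn, MLD T0 Tinf & MLD Tn Tinf])
    & (forall z (n : nat), tbd (TG P T G) z ->
         lam ^+ n *: psi_inf lam psi z =
         psi_inf lam psi (iter n (lampsi lam psi) z))].
Proof.
have tbdE := tbd_TG GS_recurrent G_arcs TG_tiling.
have mld f f_tile f_shift : MLD T (deform f (TG P T G)) :=
  deform_MLD T_tiling GS_recurrent G_arcs TG_tiling f_tile f_shift.
split=> [z _|z t|n T0 Tn Tinf|z n].
- exact: psin1 T_self_similar z.
- rewrite tbdE => Gz Tt tz n.
  exact: psin_tile T_tiling T_self_similar GS_recurrent S_sub_RG G_arcs TG_tiling psi_def n _ _ Gz Tt tz.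
- have M0 : MLD T T0 by rewrite /T0 -(deform_id TG_tiling); exact: mld.
  have Mn : MLD T Tn.
    apply: mld => [z t|z t w].
      exact: psin_tile T_tiling T_self_similar GS_recurrent S_sub_RG G_arcs TG_tiling psi_def n z t.
    exact: psin_shift T_tiling T_self_similar GS_recurrent S_sub_RG G_arcs TG_tiling psi_def n z t w.
  have Mi : MLD T Tinf.
    apply: mld => [z t|z t w].
      exact: psi_inf_tile T_tiling T_self_similar GS_recurrent S_sub_RG G_arcs TG_tiling psi_def z t.
    exact: psi_inf_shift T_tiling T_self_similar GS_recurrent S_sub_RG G_arcs TG_tiling psi_def z t w.
  (* The relations among the deformed tilings all pass through [T]. *)
  by do 2!split => //; apply: MLD_trans (MLD_sym _) _; eassumption.
- rewrite tbdE => Gz; apply/esym.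
  exact: psi_inf_iter T_tiling T_self_similar GS_recurrent S_sub_RG G_arcs TG_tiling psi_def z n Gz.
Qed.
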